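(* Let $K$ be a field of characteristic $p>0$ and $\Lambda=K[x][y;f\frac{d}{dx}]$ where $f\in K[x]\setminus K$. Then: 1. The Krull dimension of $\Lambda$ is $\mathrm{Kdim}(\Lambda)=2$. 2. The global dimension of $\Lambda$ is $\mathrm{gldim}(\Lambda)=2$.
   Context: $\Lambda=K[x][y;f\frac{d}{dx}]=K\langle x,y\mid yx-xy=f\rangle=\bigoplus_{i\ge0}K[x]y^i$ is an Ore extension. The Krull dimension is the (Gabriel–Rentschler) Krull dimension of the Noetherian ring $\Lambda$. *)

(* Defs.v *)
From HB Require Import structures.
From mathcomp Require Import all_boot all_order all_algebra.
From mathcomp Require Import boolp classical_sets.

Set Implicit Arguments.
Unset Strict Implicit.
Unset Printing Implicit Defensive.

Import Order.TTheory GRing.Theory.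
Local Open Scope classical_set_scope.
Local Open Scope ring_scope.

Record derivation (R : nzRingType) := Derivation {
  derivation_fun :> {additive R -> R};
  derivationM : forall a b,
    derivation_fun (a * b) = derivation_fun a * b + a * derivation_fun b }.

(* The Ore extension R[y; delta]: the polynomial \sum_i a_i 'X^i stands for
   \sum_i a_i y^i (coefficients on the left), and the product is determined by
   y a = a y + delta a. *)
Definition ore (R : nzRingType) (delta : derivation R) : Type := {poly R}.

HB.instance Definition _ (R : nzRingType) (delta : derivation R) :=
  GRing.Zmodule.on (ore delta).

Section Ore.
Variables (R : nzRingType) (delta : derivation R).
Implicit Types (p q r : {poly R}) (a b : R).

(* Left multiplication by y. *)
Definition ore_lmuly q : {poly R} := q * 'X + map_poly delta q.

Definition ore_mul p q : {poly R} :=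
  \sum_(i < size p) p`_i *: iter i ore_lmuly q.

Fact ore_lmuly_is_additive : zmod_morphism ore_lmuly.
Proof. by move=> p q; rewrite /ore_lmuly mulrBl raddfB /= addrACA opprD. Qed.
HB.instance Definition _ :=
  GRing.isZmodMorphism.Build _ _ ore_lmuly ore_lmuly_is_additive.

Fact ore_lmulyZ a q :
  ore_lmuly (a *: q) = a *: ore_lmuly q + delta a *: q.
Proof.
rewrite /ore_lmuly scalerDr scalerAl -addrA; congr (_ + _).
apply/polyP=> i; rewrite coefD !coefZ !coef_map_id0 ?raddf0 // coefZ.
by rewrite derivationM addrC.
Qed.

Fact iter_ore_lmulyB i p q :
  iter i ore_lmuly (p - q) = iter i ore_lmuly p - iter i ore_lmuly q.
Proof. by elim: i => //= i ->; rewrite raddfB. Qed.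

Fact iter_ore_lmuly0 i : iter i ore_lmuly 0 = 0.
Proof. by elim: i => //= i ->; rewrite raddf0. Qed.

Fact ore_mul_wide n p q : (size p <= n)%N ->
  ore_mul p q = \sum_(i < n) p`_i *: iter i ore_lmuly q.
Proof.
move=> lepn; rewrite /ore_mul (big_ord_widen n (fun i => p`_i *: iter i ore_lmuly q)) //.
rewrite big_mkcond; apply: eq_bigr => i _; case: ltnP => // lepi.
by rewrite nth_default // scale0r.
Qed.

Fact ore_mulDl : left_distributive ore_mul +%R.
Proof.
move=> p q r; set n := maxn (size p) (size q).
rewrite !(@ore_mul_wide n) ?leq_maxl ?leq_maxr ?size_polyD //.
by rewrite -big_split /=; apply: eq_bigr => i _; rewrite coefD scalerDl.
Qed.

Fact ore_mulBr p q r : ore_mul p (q - r) = ore_mul p q - ore_mul p r.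
Proof.
rewrite /ore_mul -sumrB; apply: eq_bigr => i _.
by rewrite iter_ore_lmulyB scalerBr.
Qed.

Fact ore_mulDr : right_distributive ore_mul +%R.
Proof.
have mul0 p : ore_mul p 0 = 0.
  by rewrite /ore_mul big1 // => i _; rewrite iter_ore_lmuly0 scaler0.
by move=> p q r; rewrite -[r in LHS]opprK ore_mulBr -[- r]add0r ore_mulBr mul0 add0r opprK.
Qed.

Fact ore_mul0r q : ore_mul 0 q = 0.
Proof. by rewrite /ore_mul size_poly0 big_ord0. Qed.

Fact ore_mulZl a p q : ore_mul (a *: p) q = a *: ore_mul p q.
Proof.
rewrite (@ore_mul_wide (size p)) ?size_scale_leq //.
by rewrite scaler_sumr; apply: eq_bigr => i _; rewrite coefZ scalerA.
Qed.

Fact ore_mul_lmuly p q : ore_mul (ore_lmuly p) q = ore_lmuly (ore_mul p q).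
Proof.
have lemap : (size (map_poly delta p) <= (size p).+1)%N.
  by apply: leq_trans (size_poly _ _) _.
have leX : (size (p * 'X)%R <= (size p).+1)%N.
  by apply: leq_trans (size_polyMleq _ _) _; rewrite size_polyX addn2.
rewrite {1}/ore_lmuly ore_mulDl !(@ore_mul_wide (size p).+1 (_ * _)) //.
rewrite (@ore_mul_wide (size p) (map_poly _ _)) ?size_poly // /ore_mul raddf_sum /=.
rewrite big_ord_recl coefMX eqxx scale0r add0r -big_split /=.
apply: eq_bigr => i _; rewrite ore_lmulyZ coefMX /=.
by rewrite coef_map_id0 ?raddf0.
Qed.

Fact ore_mulA : associative ore_mul.
Proof.
move=> p q r; rewrite {2}/ore_mul.
have suml n (F : nat -> {poly R}) :
    ore_mul (\sum_(i < n) F i) r = \sum_(i < n) ore_mul (F i) r.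
  elim: n => [|n IHn]; first by rewrite !big_ord0 ore_mul0r.
  by rewrite !big_ord_recr ore_mulDl IHn.
rewrite (suml _ (fun i => p`_i *: iter i ore_lmuly q)) {1}/ore_mul.
apply: eq_bigr => i _; rewrite ore_mulZl; congr (_ *: _).
by elim: (nat_of_ord i) => //= k ->; rewrite ore_mul_lmuly.
Qed.

Fact ore_mulCl a q : ore_mul a%:P q = a *: q.
Proof. by rewrite (@ore_mul_wide 1) ?size_polyC_leq1 // big_ord1 coefC. Qed.

Fact ore_mul1r : left_id 1 ore_mul.
Proof. by move=> q; rewrite ore_mulCl scale1r. Qed.

Fact iter_ore_lmuly1 i : iter i ore_lmuly 1 = 'X^i.
Proof.
elim: i => [|i IHi] /=; first by rewrite expr0.
rewrite IHi /ore_lmuly -exprSr -[RHS]addr0; congr (_ + _).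
apply/polyP=> j; rewrite coef_map_id0 ?raddf0 // coefXn coef0.
have delta1 : delta 1 = 0.
  have /eqP := derivationM delta 1 1.
  by rewrite !(mulr1, mul1r) -subr_eq subrr => /eqP <-.
by case: eqP; rewrite ?delta1 ?raddf0.
Qed.

Fact ore_mulr1 : right_id 1 ore_mul.
Proof.
move=> p; rewrite /ore_mul -[RHS]coefK poly_def.
by apply: eq_bigr => i _; rewrite iter_ore_lmuly1.
Qed.

Fact ore_1neq0 : (1 : {poly R}) != 0. Proof. exact: oner_neq0. Qed.

HB.instance Definition _ := GRing.Zmodule_isNzRing.Build (ore delta)
  ore_mulA ore_mul1r ore_mulr1 ore_mulDl ore_mulDr ore_1neq0.

Definition oreC a : ore delta := a%:P.
Definition ore_y : ore delta := 'X : {poly R}.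

Fact oreC_is_zmod_morphism : zmod_morphism oreC.
Proof. exact: polyCB. Qed.
Fact oreC_is_monoid_morphism : monoid_morphism oreC.
Proof.
split=> // a b; rewrite /oreC; apply: (etrans _ (esym (ore_mulCl a b%:P))).
by rewrite -mul_polyC polyCM.
Qed.
HB.instance Definition _ :=
  GRing.isZmodMorphism.Build R (ore delta) oreC oreC_is_zmod_morphism.
HB.instance Definition _ :=
  GRing.isMonoidMorphism.Build R (ore delta) oreC oreC_is_monoid_morphism.

Lemma ore_lmulyE (q : ore delta) : ore_y * q = ore_lmuly q.
Proof.
apply: (etrans (@ore_mul_wide 2 _ _ _)); first by rewrite size_polyX.
by rewrite big_ord_recl big_ord1 !coefX /= scale0r scale1r add0r.
Qed.

Lemma ore_yC a : ore_y * oreC a = oreC a * ore_y + oreC (delta a).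
Proof.
rewrite ore_lmulyE.
have -> : oreC a * ore_y = a *: 'X :> {poly R} by exact: ore_mulCl.
by rewrite /ore_lmuly /oreC map_polyC mul_polyC.
Qed.

Lemma oreE (p : ore delta) :
  p = \sum_(i < size (p : {poly R})) oreC (p : {poly R})`_i * ore_y ^+ i.
Proof.
have yX i : ore_y ^+ i = 'X^i :> {poly R}.
  by rewrite -iter_ore_lmuly1; elim: i => //= i <-; rewrite exprS ore_lmulyE.
apply: (etrans (esym (coefK (p : {poly R})))); rewrite poly_def.
apply: eq_bigr => i _; rewrite -(yX i); exact: esym (ore_mulCl _ _).
Qed.

End Ore.

(* The derivation f d/dx of K[x]. *)
Section FDeriv.
Variables (K : fieldType) (f : {poly K}).

Definition fderiv (a : {poly K}) : {poly K} := f * a^`().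

Fact fderiv_is_zmod_morphism : zmod_morphism fderiv.
Proof. by move=> a b; rewrite /fderiv derivB mulrBr. Qed.
HB.instance Definition _ :=
  GRing.isZmodMorphism.Build _ _ fderiv fderiv_is_zmod_morphism.

Fact fderivM a b : fderiv (a * b) = fderiv a * b + a * fderiv b.
Proof. by rewrite /fderiv derivM mulrDr mulrA [f * (a * _)]mulrCA. Qed.

Definition fderivation : derivation {poly K} := Derivation fderivM.

(* Lambda = K[x][y; f d/dx] = K<x, y | y x - x y = f> *)
Definition Lambda : nzRingType := ore fderivation.

Definition Lambda_x : Lambda := oreC fderivation 'X.
Definition Lambda_y : Lambda := ore_y fderivation.

Lemma Lambda_yx :
  Lambda_y * Lambda_x - Lambda_x * Lambda_y = oreC fderivation f.
Proof.
by rewrite /Lambda_y /Lambda_x ore_yC addrAC subrr add0r /= /fderiv derivX mulr1.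
Qed.

End FDeriv.

(* The deviation of the poset D is less than n: the case n = 0 says that D is
   trivial (no two distinct comparable elements), hence n = 1 is the descending
   chain condition. *)
Fixpoint deviation_lt {disp : Order.disp_t} {T : porderType disp}
    (n : nat) (D : set T) : Prop :=
  if n is n'.+1 then
    forall u : nat -> T, (forall i, D (u i)) ->
      (forall i, (u i.+1 <= u i)%O) ->
      exists N, forall i, (N <= i)%N ->
        deviation_lt n' (D `&` [set t | (u i.+1 <= t)%O && (t <= u i)%O])
  else forall s t, D s -> D t -> (s <= t)%O -> s = t.

Definition deviation_eq {disp : Order.disp_t} {T : porderType disp}
    (D : set T) (n : nat) : Prop :=
  deviation_lt n.+1 D /\ ~ deviation_lt n D.

Definition submodules (R : nzRingType) (M : lmodType R) : set (set M) :=
  [set N : set M | submod_closed (mem N)].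
Arguments submodules {R} M _.

(* Gabriel-Rentschler Krull dimension of a left module; right R-modules are
   left R^c-modules. *)
Definition Kdim_eq (R : nzRingType) (M : lmodType R) (n : nat) : Prop :=
  deviation_eq (submodules M) n.

Definition lKdim_eq (R : nzRingType) (n : nat) : Prop := @Kdim_eq R R^o n.

Definition rKdim_eq (R : nzRingType) (n : nat) : Prop := lKdim_eq R^c n.

Definition projective (R : nzRingType) (P : lmodType R) : Prop :=
  forall (A B : lmodType R) (g : {linear A -> B}) (h : {linear P -> B}),
    range g = setT -> exists k : {linear P -> A}, g \o k =1 h.

(* M has a projective resolution
   0 -> P_n -> ... -> P_1 -> P_0 -> M -> 0. *)
Definition pdim_le (R : nzRingType) (M : lmodType R) (n : nat) : Prop :=
  exists (P : nat -> lmodType R) (d : forall i, {linear P i.+1 -> P i})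
         (e : {linear P 0%N -> M}),
    [/\ forall i, projective (P i),
        forall i, (n < i)%N -> forall x : P i, x = 0,
        range e = setT,
        range (d 0%N) = [set x | e x = 0]
      & forall i, range (d i.+1) = [set x | d i x = 0]].

Definition lgldim_le (R : nzRingType) (n : nat) : Prop :=
  forall M : lmodType R, pdim_le M n.

Definition lgldim_eq (R : nzRingType) (n : nat) : Prop :=
  lgldim_le R n /\ forall m, lgldim_le R m -> (n <= m)%N.

Definition rgldim_eq (R : nzRingType) (n : nat) : Prop := lgldim_eq R^c n.

(* Main.v *)
(* Write A for Lambda or its opposite ring; in either case A is free over K[x]
   on the powers of y, with y a = a y + g a' and g = f or g = - f.

   Krull dimension. A left ideal I is determined, within a given left ideal
   containing it, by the pairs (n, k) for which I has an element of y-degree n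
   whose leading coefficient has size at most k. These pairs form an up-set of
   nat * nat, and the poset of up-sets has deviation 2. Conversely g is a
   nonunit normal element: for the left ideals L i j of the p divisible by g^i
   whose coefficients of degree < j are divisible by g^(i+1), the chain
   (L i 0)_i is decreasing and (L i j)_j is infinite strictly decreasing
   between L i 0 and L (i+1) 0.

   Global dimension. For every A-module M, the Koszul-type complex
     0 -> A (x)_K M -> (A (x)_K M)^2 -> A (x)_K M -> M -> 0
   attached to the generators x, y and the relation y x - x y = g is exact, and
   its terms are free because M has a K-basis. Conversely A / (A g + A y) has
   projective dimension 2: otherwise A^2 -> A g + A y would split, and the
   relation (y - g') g = g y would force 1 into A g + A y. *)
Require Import Defs.
From HB Require Import structures.
From mathcomp Require Import all_boot all_order all_algebra.
From mathcomp Require Import boolp classical_sets.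
From mathcomp Require Import generic_quotient ring_quotient.
From mathcomp Require Import finmap monalg.
From mathcomp Require Import zify ring.

Set Implicit Arguments.
Unset Strict Implicit.
Unset Printing Implicit Defensive.

Import Order.TTheory GRing.Theory.
Local Open Scope classical_set_scope.
Local Open Scope ring_scope.

(** * Deviation of posets of up-sets *)

Section Deviation.
Variables (disp : Order.disp_t) (T : porderType disp).
Implicit Types (D : set T) (s t : T).

Lemma nonincreasing_nat_stationary (u : nat -> nat) :
  (forall i, (u i.+1 <= u i)%N) -> exists N, forall i, (N <= i)%N -> u i = u N.
Proof.
move=> u_anti; have anti i j : (i <= j)%N -> (u j <= u i)%N.
  by move=> /subnKC <-; elim: (j - i)%N => [|n IHn]; rewrite ?addn0 // addnS (leq_trans (u_anti _)).
have [n [[N uN] n_min]] : exists n, (exists N, u N = n) /\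
    forall m, (exists N, u N = m) -> (n <= m)%N.
  have exP : exists n, `[< exists N, u N = n >] by exists (u 0%N); apply/asboolP; exists 0%N.
  have [n /asboolP Pn n_min] := ex_minnP exP.
  by exists n; split=> // m Pm; apply: n_min; apply/asboolP.
exists N => i leNi; apply/eqP; rewrite eqn_leq anti //= uN n_min //; by exists i.
Qed.

Lemma deviation_lt_trivial n D : deviation_lt 0 D -> deviation_lt n D.
Proof.
elim: n D => //= n IHn D D0 u Du u_anti; exists 0%N => i _; apply: IHn => s t [Ds _] [Dt _].
exact: D0.
Qed.

(** A monotone rank is eventually constant along a descending chain, so only intervals with equal
    ranks at both ends matter; each rank costs one unit of deviation. *)
Lemma deviation_lt_rank n D (c : T -> nat) :
  (forall s t, D s -> D t -> (s <= t)%O -> (c s <= c t)%N) ->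
  (forall s t, D s -> D t -> (s <= t)%O -> c s = c t ->
     deviation_lt n (D `&` [set r | (s <= r)%O && (r <= t)%O])) ->
  deviation_lt n.+1 D.
Proof.
move=> c_mono Dc u Du u_anti.
have [N uN] : exists N, forall i, (N <= i)%N -> c (u i) = c (u N).
  by apply: (@nonincreasing_nat_stationary (c \o u)) => i /=; apply: c_mono.
by exists N => i leNi; apply: Dc => //; rewrite !uN // leqW.
Qed.

(** Finitely many rows have a common bound for their witnesses; it will confine the difference of
    two up-sets to a finite square. *)
Lemma bounded_witnesses (P : nat -> nat -> Prop) m : exists N, forall a,
  (a < m)%N -> (exists b, P a b) -> exists2 b, (b <= N)%N & P a b.
Proof.
elim: m => [|m [N IHm]]; first by exists 0%N.
have [[b Pmb]|nPm] := pselect (exists b, P m b).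
  exists (maxn N b) => a; rewrite ltnS leq_eqVlt => /predU1P[-> _|/IHm{}IHm /IHm[c leN Pac]].
    by exists b; rewrite ?leq_maxr.
  by exists c; rewrite // leq_max leN.
by exists N => a; rewrite ltnS leq_eqVlt => /predU1P[->|/IHm].
Qed.

(* A poset that embeds, strictly monotonically, in the poset of up-sets of
   [nat * nat] has deviation at most 2: an up-set is determined, above a given
   nonempty one, by finitely many rows and columns. *)
Lemma deviation_lt_upset D (phi : T -> nat -> nat -> Prop) :
  (forall t a b a' b', D t -> phi t a b -> (a <= a')%N -> (b <= b')%N -> phi t a' b') ->
  (forall s t a b, D s -> D t -> (s <= t)%O -> phi s a b -> phi t a b) ->
  (forall s t, D s -> D t -> (s <= t)%O ->
     (forall a b, phi t a b -> phi s a b) -> s = t) ->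
  deviation_lt 3 D.
Proof.
move=> up mono strict.
pose ne t := exists a b, phi t a b.
(* First rank: empty or nonempty. Between two empty up-sets the interval is trivial by [strict]. *)
apply: (@deviation_lt_rank _ _ (fun t => nat_of_bool `[< ne t >])) => [s t Ds Dt st|s t Ds Dt st].
  case: asboolP => // -[a [b sab]]; case: asboolP => // nt.
  by case: nt; exists a, b; apply: mono sab.
case: (asboolP (ne s)) => s1; case: (asboolP (ne t)) => t1 // _; last first.
  have -> : s = t by apply: strict => // a b tab; case: t1; exists a, b.
  apply: deviation_lt_trivial => u v [_ /andP[tu ut]] [_ /andP[tv vt]] _.
  by transitivity t; apply/le_anti; rewrite ?tu ?tv ?ut ?vt.
(* Every up-set above [s] contains the quadrant at [(m, k)], so only the columns [a < m] and the
   rows [b < k] remain to be controlled. *)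
have [m [k smk]] := s1; set D1 := _ `&` _.
pose cols t := [set a : 'I_m | `[< exists b, phi t a b >]]%SET.
pose rows t := [set b : 'I_k | `[< exists a, phi t a b >]]%SET.
have colsS u v : D1 u -> D1 v -> (u <= v)%O -> cols u \subset cols v.
  move=> [Du _] [Dv _] uv; apply/fintype.subsetP => a; rewrite !inE => /asboolP[b ub].
  by apply/asboolP; exists b; apply: mono ub.
have rowsS u v : D1 u -> D1 v -> (u <= v)%O -> rows u \subset rows v.
  move=> [Du _] [Dv _] uv; apply/fintype.subsetP => a; rewrite !inE => /asboolP[b ub].
  by apply/asboolP; exists b; apply: mono ub.
(* Second rank: how many of these columns and rows are met. *)
apply: (@deviation_lt_rank _ _ (fun t => #|cols t| + #|rows t|)%N).
  by move=> u v Du Dv uv; rewrite leq_add ?fintype.subset_leq_card ?colsS ?rowsS.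
move=> u v Du Dv uv eq_card.
have /setP eqc : cols u = cols v.
  by apply/eqP; rewrite eqEcard colsS //= -(leq_add2r #|rows v|) -eq_card leq_add2l
    fintype.subset_leq_card ?rowsS.
have /setP eqr : rows u = rows v.
  by apply/eqP; rewrite eqEcard rowsS //= -(leq_add2l #|cols v|) -eq_card leq_add2r
    fintype.subset_leq_card ?colsS.
have [N1 hN1] := bounded_witnesses (phi u) m.
have [N2 hN2] := bounded_witnesses (fun b a => phi u a b) k.
have umk : phi u m k by case: Du => Du /andP[su _]; apply: mono smk.
(* When [u] and [v] meet the same columns and rows, [u] already fills each of them from [N1],
   respectively [N2], onwards, so [v] exceeds [u] only inside the square of side [N]. *)
pose N := (m + k + N1 + N2)%N.
have vu a b : phi v a b -> phi u a b \/ (a < N)%N /\ (b < N)%N.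
  move=> vab; have [ltam|leam] := ltnP a m.
    have := eqc (Ordinal ltam); rewrite !inE /= => e; have h := asbool_eq_equiv e.
    have [b' leb uab'] := hN1 _ ltam (h.2 (ex_intro _ b vab)).
    have [lebb|ltbb] := leqP b' b; first by left; apply: up uab' _ lebb; case: Du.
    by right; rewrite /N; split; lia.
  have [ltbk|lebk] := ltnP b k.
    have := eqr (Ordinal ltbk); rewrite !inE /= => e; have h := asbool_eq_equiv e.
    have [a' lea uab'] := hN2 _ ltbk (h.2 (ex_intro _ a vab)).
    have [leaa|ltaa] := leqP a' a; first by left; apply: up uab' leaa _; case: Du.
    by right; rewrite /N; split; lia.
  by left; apply: up umk leam lebk; case: Du.
set D2 := _ `&` _.
(* Third rank: the number of points in this square, which are all that can vary between [u] and
   [v]. *)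
pose pts t := [set x : 'I_N * 'I_N | `[< phi t x.1 x.2 >]]%SET.
have ptsS w z : D2 w -> D2 z -> (w <= z)%O -> pts w \subset pts z.
  move=> [[Dw _] _] [[Dz _] _] wz; apply/fintype.subsetP => x; rewrite !inE => /asboolP wx.
  by apply/asboolP; apply: mono wx.
apply: (@deviation_lt_rank _ _ (fun t => #|pts t|)%N).
  by move=> w z Dw Dz wz; rewrite fintype.subset_leq_card ?ptsS.
move=> w z Dw Dz wz eq_pts.
have /setP eqp : pts w = pts z by apply/eqP; rewrite eqEcard ptsS //= eq_pts.
suff -> : w = z.
  move=> x y [_ /andP[zx xz]] [_ /andP[zy yz]] _.
  by transitivity z; apply/le_anti; rewrite ?zx ?zy ?yz ?xz.
have [Dw1 [Dz1 [zv uw]]] : D w /\ D z /\ (z <= v)%O /\ (u <= w)%O.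
  by case: Dw Dz => [[? _] /andP[? ?]] [[? _] /andP[? ?]].
have [Du1 Dv1] : D u /\ D v by case: Du Dv => ? _ [].
apply: strict => // a b zab.
have [uab|[ltaN ltbN]] := vu a b (mono _ _ _ _ Dz1 Dv1 zv zab).
  exact: mono uab.
have := eqp (Ordinal ltaN, Ordinal ltbN); rewrite !inE /= => e; exact/(asbool_eq_equiv e).
Qed.

End Deviation.

(** * Coordinates and Krull dimension *)

Lemma submodulesP (R : nzRingType) (M : lmodType R) (N : set M) :
  submodules _ N <-> N 0 /\ forall a u v, N u -> N v -> N (a *: u + v).
Proof.
split=> [[/set_mem N0 NS]|[N0 NS]]; split=> //; last 2 first.
- exact/mem_set.
- by move=> a u v /set_mem Nu /set_mem Nv; apply/mem_set/NS.
by move=> a u v Nu Nv; apply: set_mem; apply: NS; apply: mem_set.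
Qed.

(* [ocf p] lists the coefficients of the left normal form
   [p = \sum_i oconst (ocf p)`_i * ovar ^+ i]. Both [Lambda g] and, through an
   anti-isomorphism, the opposite of [Lambda (- g)] have such coordinates. *)
Record ore_coords (K : fieldType) (g : {poly K}) (A : nzRingType) := OreCoords {
  oconst : {rmorphism {poly K} -> A};
  ovar : A;
  ocf : A -> {poly {poly K}};
  ocfB : zmod_morphism ocf;
  ocf_inj : injective ocf;
  ocf1 : ocf 1 = 1;
  ocfZ : forall a p, ocf (oconst a * p) = a *: ocf p;
  ocfY : forall p, ocf (ovar * p) = ore_lmuly (fderivation g) (ocf p) }.

Section OreCoords.
Variables (K : fieldType) (g : {poly K}) (A : nzRingType) (D : ore_coords g A).
Local Notation C := (oconst D).
Local Notation y := (ovar D).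
Local Notation cf := (ocf D).

HB.instance Definition _ := GRing.isZmodMorphism.Build A {poly {poly K}} cf (ocfB D).

Lemma ocfC a : cf (C a) = a%:P.
Proof. by rewrite -[C a]mulr1 ocfZ ocf1 alg_polyC. Qed.

Lemma ocf_eq0 p : (cf p == 0) = (p == 0).
Proof. by apply/eqP/eqP => [cfp0|->]; [apply: (@ocf_inj _ _ _ D)|]; rewrite raddf0. Qed.

Lemma ocfYXn i : cf (y ^+ i) = 'X^i.
Proof.
rewrite -(iter_ore_lmuly1 (fderivation g)).
by elim: i => [|i IHi]; rewrite ?ocf1 // exprS ocfY IHi.
Qed.

Lemma coef_ocfY p k :
  (cf (y * p))`_k = (if k is k'.+1 then (cf p)`_k' else 0) + g * ((cf p)`_k)^`().
Proof.
rewrite ocfY /ore_lmuly coefD coefMX coef_map_id0 ?raddf0 //.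
by case: k.
Qed.

Lemma ovarC a : y * C a = C a * y + C (g * a^`()).
Proof.
apply: (@ocf_inj _ _ _ D); rewrite raddfD /= ocfY ocfZ !ocfC -[y]expr1 ocfYXn.
by rewrite /ore_lmuly map_polyC mul_polyC.
Qed.

Lemma ore_coordsE p : p = \sum_(i < size (cf p)) C (cf p)`_i * y ^+ i.
Proof.
apply: (@ocf_inj _ _ _ D); rewrite raddf_sum /= -[LHS]coefK poly_def.
by apply: eq_bigr => i _; rewrite ocfZ ocfYXn.
Qed.

Lemma ore_coords_ind (P : A -> Prop) :
  P 0 -> (forall p q, P p -> P q -> P (p + q)) ->
  (forall a i, P (C a * y ^+ i)) -> forall p, P p.
Proof. by move=> P0 PD Py p; rewrite [p]ore_coordsE; elim/big_ind: _. Qed.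

Lemma ore_scale_closed (V : lmodType A) (N : V -> Prop) :
  N 0 -> (forall u v, N u -> N v -> N (u + v)) ->
  (forall a v, N v -> N (C a *: v)) -> (forall v, N v -> N (y *: v)) ->
  forall a v, N v -> N (a *: v).
Proof.
move=> N0 ND NC NY a v Nv; elim/ore_coords_ind: a => [|p q Np Nq|a i].
- by rewrite scale0r.
- by rewrite scalerDl; apply: ND.
rewrite -scalerA; apply: NC.
by elim: i => [|i IHi]; rewrite ?expr0 ?scale1r // exprS -scalerA; apply: NY.
Qed.

Lemma size_ocfY p : p != 0 -> size (cf (y * p)) = (size (cf p)).+1.
Proof.
rewrite -ocf_eq0 ocfY => q0; rewrite size_polyDl ?size_mulX // ltnS.
exact: size_poly.
Qed.

Lemma lead_coef_ocfY p : p != 0 -> lead_coef (cf (y * p)) = lead_coef (cf p).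
Proof.
rewrite -ocf_eq0 ocfY => q0; rewrite lead_coefDl ?lead_coefMX //.
by rewrite size_mulX // ltnS size_poly.
Qed.

Lemma ore_submodules (V : lmodType A) (N : set V) :
  N 0 -> (forall u v, N u -> N v -> N (u + v)) ->
  (forall a v, N v -> N (C a *: v)) -> (forall v, N v -> N (y *: v)) ->
  submodules _ N.
Proof.
move=> N0 ND NC NY; apply/submodulesP; split=> // a u v Nu Nv.
by apply: (ND (a *: u) v _ Nv); apply: (ore_scale_closed N0 ND NC NY).
Qed.

(** Size [n.+1] means y-degree [n] and excludes [p = 0]; bounding the size of the leading
    coefficient, rather than prescribing it, makes the set upward closed in [k]. *)
Definition leading_degrees (I : set A) (n k : nat) := exists p,
  [/\ I p, size (cf p) = n.+1 & (size (lead_coef (cf p)) <= k)%N].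

(** Induction on the y-degree of [p] in [J]. A leading coefficient of least size in that degree is
    attained by some [q] in [I]; dividing that of [p] by it leaves remainder zero by minimality, so
    subtracting a multiple of [q] lowers the degree. *)
Lemma leading_degrees_strict (I J : set A^o) : submodules _ I -> submodules _ J ->
  I `<=` J -> (forall n k, leading_degrees J n k -> leading_degrees I n k) -> I = J.
Proof.
move=> /submodulesP[I0 IS] /submodulesP[J0 JS] IJ JI; apply/seteqP; split=> // p.
have [n] := ubnP (size (cf p)); elim: n => // n IHn in p *; rewrite ltnS => szp Jp.
have [->//|p0] := eqVneq p 0.
have cfp0 : cf p != 0 by rewrite ocf_eq0.
have szp1 : size (cf p) = (size (cf p)).-1.+1 by rewrite prednK ?size_poly_gt0.
set m := (size (cf p)).-1 in szp1.
have exk : exists k, `[< leading_degrees J m k >].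
  by exists (size (lead_coef (cf p))); apply/asboolP; exists p.
have [k /asboolP/JI[q [Iq szq lek]] k_min] := ex_minnP exk.
have lq0 : lead_coef (cf q) != 0 by rewrite lead_coef_eq0 -size_poly_eq0 szq.
set b := lead_coef (cf p) %/ lead_coef (cf q).
set p' := p - C b * q.
have Jp' : J p' by rewrite /p' addrC -mulNr -rmorphN; apply: JS => //; apply: IJ.
have Ip' : I p'.
  apply: IHn => //; apply: leq_trans szp; rewrite szp1 ltnS.
  have szp' : (size (cf p') <= m.+1)%N.
    rewrite raddfB /= ocfZ (leq_trans (size_polyD _ _)) // size_polyN geq_max -szp1 leqnn /=.
    by rewrite (leq_trans (size_scale_leq _ _)) // szq szp1.
  have p'm : (cf p')`_m = lead_coef (cf p) %% lead_coef (cf q).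
    have -> : (cf p')`_m = lead_coef (cf p) - b * lead_coef (cf q).
      by rewrite raddfB /= ocfZ coefB coefZ !lead_coefE szq szp1.
    by rewrite {1}[lead_coef (cf p)](divp_eq _ (lead_coef (cf q))) addrC addKr.
  rewrite leqNgt; apply/negP => ltm.
  have {ltm}szp' : size (cf p') = m.+1 by apply/eqP; rewrite eqn_leq szp' ltm.
  have : (k <= size (lead_coef (cf p')))%N by apply: k_min; apply/asboolP; exists p'.
  rewrite lead_coefE szp' /= p'm leqNgt => /negP[]; apply: leq_trans lek.
  by rewrite ltn_modp.
by rewrite -(subrK (C b * q) p) addrC; apply: IS.
Qed.

Lemma ore_Kdim_le2 : deviation_lt 3 (submodules A^o).
Proof.
apply: (@deviation_lt_upset _ _ _ leading_degrees) => [I n k n' k' ID|I J n k _ _ IJ|].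
(* Multiplication by [y] raises the degree by one and keeps the leading coefficient. *)
- move=> [p [Ip szp lep]] /subnKC <- lek; elim: (n' - n)%N => [|i [q [Iq szq leq]]].
    by exists p; rewrite addn0; split=> //; apply: leq_trans lek.
  have q0 : q != 0 by rewrite -ocf_eq0 -size_poly_eq0 szq.
  exists (y * q); rewrite size_ocfY // lead_coef_ocfY // szq addnS; split=> //.
  by have [I0 IS] := (submodulesP _).1 ID; rewrite -[_ * _]addr0; apply: IS.
- by case=> p [Ip szp lep]; exists p; split=> //; move: IJ; rewrite subsetEset; apply.
- by move=> I J ID JD; rewrite subsetEset; apply: leading_degrees_strict.
Qed.

(** Differentiation loses at most one factor [g], which the multiplication by [g] restores. This
    makes the sets [L i j] below stable under [y]. *)
Lemma dvdp_deriv_exp m (a : {poly K}) : g ^+ m %| a -> g ^+ m %| g * a^`().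
Proof.
move=> /dvdpP[b ->]; rewrite derivM deriv_exp mulrDr dvdp_add //.
  by rewrite mulrA dvdp_mull.
case: m => [|m]; first by rewrite mulr0n !mulr0 dvdp0.
rewrite -mulr_natl [_.-1]/= exprS.
have -> : g * (b * (m.+1%:R * (g^`() * g ^+ m))) = (b * m.+1%:R * g^`()) * (g * g ^+ m) by ring.
exact: dvdp_mull.
Qed.

Hypothesis g_nonconst : (1 < size g)%N.

Lemma ore_Kdim_ge2 : ~ deviation_lt 2 (submodules A^o).
Proof.
have dvdS i (a : {poly K}) : g ^+ i.+1 %| a -> g ^+ i %| a.
  by apply: dvdp_trans; rewrite exprS dvdp_mull.
pose L i j : set A^o := [set p | forall k,
  g ^+ i %| (cf p)`_k /\ ((k < j)%N -> g ^+ i.+1 %| (cf p)`_k)].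
have DL i j : submodules _ (L i j).
  apply: ore_submodules => [k|p q Lp Lq k|a p Lp k|p Lp k].
  - by rewrite raddf0 coef0 !dvdp0.
  - have [p1 p2] := Lp k; have [q1 q2] := Lq k; rewrite raddfD coefD /=.
    by split=> [|ltk]; rewrite dvdp_add ?p1 ?q1 ?p2 ?q2.
  - have [p1 p2] := Lp k; rewrite ocfZ coefZ.
    by split=> [|ltk]; rewrite dvdp_mull ?p1 ?p2.
  have [p1 p2] := Lp k; rewrite coef_ocfY.
  split=> [|ltk]; rewrite dvdp_add ?dvdp_deriv_exp ?p2 //.
    by case: k {p1 p2} => [|k]; [rewrite dvdp0|have [] := Lp k].
  by case: k ltk {p1 p2} => [_|k ltk]; [rewrite dvdp0|have [_] := Lp k; apply; apply: ltnW].
(* For the [N] obtained here, the interval from [L N.+1 0] to [L N 0] would satisfy the descending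
   chain condition. It contains every [L N j], so two consecutive ones would coincide. *)
move=> /(_ (L^~ 0%N) (DL^~ 0%N)) [i|N /(_ N (leqnn N))].
  rewrite subsetEset => p Lp k; split=> //; have [p1 _] := Lp k.
  exact: dvdS.
move=> /(_ (L N)) [j|j|j /(_ j (leqnn j))].
- split; first exact: DL.
  apply/andP; split; rewrite subsetEset => p Lp k; last by have [] := Lp k.
  have [p1 _] := Lp k; split=> //.
  exact: dvdS.
- rewrite subsetEset => p Lp k; have [p1 p2] := Lp k; split=> // ltk.
  by apply: p2; apply: ltnW.
have LS : (L N j.+1 <= L N j)%O.
  rewrite subsetEset => p Lp k; have [p1 p2] := Lp k; split=> // ltk.
  by apply: p2; apply: ltnW.
have mid l : (submodules A^o `&` [set t | (L N.+1 0%N <= t)%O && (t <= L N 0%N)%O]) (L N l).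
  split; first exact: DL.
  apply/andP; split; rewrite subsetEset => p Lp k; last by have [] := Lp k.
  have [p1 _] := Lp k; split=> //.
  exact: dvdS.
move=> /(_ (L N j.+1) (L N j)) eqL.
(* This element is not in [L N j.+1]: its coefficient of degree [j] is [g ^+ N], which [g ^+ N.+1]
   does not divide since [g] is nonconstant. *)
have : L N j (C (g ^+ N) * y ^+ j).
  move=> k; rewrite ocfZ ocfYXn coefZ coefXn; split; first exact: dvdp_mulr.
  by case: eqP => [->|_]; rewrite ?ltnn ?mulr0 ?dvdp0.
rewrite -eqL; last exact: LS; try by split=> //; rewrite /= ?LS ?lexx.
move=> /(_ j)[_ /(_ (ltnSn j))]; rewrite ocfZ ocfYXn coefZ coefXn eqxx mulr1 exprS.
have gN0 : g ^+ N != 0 by rewrite expf_neq0 // -size_poly_gt0 ltnW.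
rewrite -[X in _ %| X]mul1r dvdp_mul2r // dvdp1 => /eqP sz.
by have := g_nonconst; rewrite sz.
Qed.

End OreCoords.

(** * Free modules and bases *)

Section FreeModules.

Lemma malg_ind (G : zmodType) (I : choiceType) (P : {malg G[I]} -> Prop) :
  P 0 -> (forall s t, P s -> P t -> P (s + t)) ->
  (forall x i, P << x *g i >>) -> forall t, P t.
Proof. by move=> P0 PD PU t; rewrite [t]monalgE; elim/big_ind: _. Qed.

Section LinearCombination.
Variables (K R : nzRingType) (kappa : {rmorphism K -> R}) (V : lmodType R).
Variables (I : choiceType) (h : I -> V).

(** The morphism [kappa] allows both combinations over a field inside an A-module and, when it is
    the identity, maps out of a free module. *)
Definition mcomb (t : {malg K[I]}) : V := \sum_(i <- msupp t) kappa t@_i *: h i.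

Lemma mcombEw (t : {malg K[I]}) (d : {fset I}) : (msupp t `<=` d)%fset ->
  mcomb t = \sum_(i <- d) kappa t@_i *: h i.
Proof.
move=> sub; apply: big_fset_incl => // i _ it.
by rewrite mcoeff_outdom // rmorph0 scale0r.
Qed.

Fact mcomb_is_zmod_morphism : zmod_morphism mcomb.
Proof.
move=> s t; pose d := (msupp s `|` msupp t)%fset.
rewrite !(@mcombEw _ d) ?fsubsetUl ?fsubsetUr ?msuppB_le // -sumrB.
by apply: eq_bigr => i _; rewrite mcoeffB rmorphB scalerBl.
Qed.
HB.instance Definition _ := GRing.isZmodMorphism.Build _ _ mcomb mcomb_is_zmod_morphism.

Lemma mcombU a i : mcomb << a *g i >> = kappa a *: h i.
Proof. by rewrite (mcombEw msuppU_le) big_seq_fset1 mcoeffUU. Qed.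

Lemma mcombZ a t : mcomb (a *: t) = kappa a *: mcomb t.
Proof.
rewrite (mcombEw (msuppZ_le a t)) scaler_sumr.
by apply: eq_bigr => i _; rewrite mcoeffZ rmorphM scalerA.
Qed.

End LinearCombination.

Section Free.
Variables (R : nzRingType) (I : choiceType) (V : lmodType R) (h : I -> V).

Definition malg_lift : {malg R[I]} -> V := mcomb idfun h.

Fact malg_lift_is_linear : linear malg_lift.
Proof. by move=> a s t; rewrite /malg_lift raddfD /= mcombZ. Qed.
HB.instance Definition _ := GRing.isLinear.Build R {malg R[I]} V _ malg_lift malg_lift_is_linear.

Lemma malg_liftU i : malg_lift << i >> = h i.
Proof. by rewrite /malg_lift mcombU scale1r. Qed.

Lemma malgUE (a : R) (i : I) : << a *g i >> = a *: << i >>.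
Proof. by apply/malgP => j; rewrite mcoeffZ !mcoeffU mulrnAr mulr1. Qed.

Lemma malg_linear_eq (u v : {linear {malg R[I]} -> V}) :
  (forall i, u << i >> = v << i >>) -> u =1 v.
Proof.
move=> uv; elim/malg_ind => [|s t us ut|a i]; first by rewrite !raddf0.
- by rewrite !raddfD /= us ut.
- by rewrite malgUE !linearZ /= uv.
Qed.

End Free.

Lemma projective_malg (R : nzRingType) (I : choiceType) : projective {malg R[I]}.
Proof.
move=> A B g h g_surj.
have /choice[k gk] : forall i, exists a, g a = h << i >>.
  by move=> i; have [a _ ga] : range g (h << i >>); [rewrite g_surj|exists a].
exists (malg_lift k); apply: (@malg_linear_eq _ _ _ (g \o malg_lift k)) => i /=.
by rewrite malg_liftU gk.
Qed.

Lemma projective_pair (R : nzRingType) (P Q : lmodType R) :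
  projective P -> projective Q -> projective (P * Q)%type.
Proof.
move=> projP projQ A B g h g_surj.
pose hP : P -> B := fun x => h (x, 0); pose hQ : Q -> B := fun x => h (0, x).
have linP : linear hP.
  by move=> a u v; rewrite /hP -linearP; congr (h _); congr (_, _); rewrite /= scaler0 addr0.
have linQ : linear hQ.
  by move=> a u v; rewrite /hQ -linearP; congr (h _); congr (_, _); rewrite /= scaler0 addr0.
have [kP gkP] := projP A B g
  (HB.pack_for {linear P -> B} hP (GRing.isLinear.Build _ _ _ _ hP linP)) g_surj.
have [kQ gkQ] := projQ A B g
  (HB.pack_for {linear Q -> B} hQ (GRing.isLinear.Build _ _ _ _ hQ linQ)) g_surj.
pose k : P * Q -> A := fun x => kP x.1 + kQ x.2.
have link : linear k by move=> a u v; rewrite /k !linearP scalerDr addrACA.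
exists (HB.pack_for {linear (P * Q)%type -> A} k (GRing.isLinear.Build _ _ _ _ k link)).
move=> -[x z] /=.
have := gkP x; have := gkQ z; rewrite /k raddfD /= => -> -> /=.
by rewrite /hP /hQ -raddfD /=; congr (h (_, _)); rewrite ?addr0 ?add0r.
Qed.

Lemma projective_trivial (R : nzRingType) (P : lmodType R) :
  (forall x : P, x = 0) -> projective P.
Proof.
move=> P0 A B g h _; exists \0 => x.
by rewrite (P0 x) /= !raddf0.
Qed.

(** * Bases over a field acting through a ring morphism *)

Section Basis.
Variables (K : fieldType) (R : nzRingType) (kappa : {rmorphism K -> R}) (M : lmodType R).

Let ev (t : {malg K[M]}) : M := mcomb kappa idfun t.
Let supported (B : set M) (t : {malg K[M]}) := forall m, t@_m != 0 -> B m.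
Let indep (B : set M) := forall t, supported B t -> ev t = 0 -> t = 0.

(** Zorn's lemma: supports are finite, so a nonzero combination over the union of a chain is already
    supported in one member. *)
Lemma maximal_independent : exists B, indep B /\ forall C, B `<` C -> ~ indep C.
Proof.
apply: (@Zorn_bigcup M indep) => F Findep Ftot t tF et.
suff [->|[X FX tX]] : t = 0 \/ exists2 X, F X & supported X t.
- by [].
- exact: (Findep _ FX) tX et.
have seqF : forall s : seq M, (forall m, m \in s -> (\bigcup_(X in F) X) m) ->
    s = [::] \/ exists2 X, F X & forall m, m \in s -> X m.
  elim=> [|m s IHs] sF; [by left|right].
  have [X FX Xm] : (\bigcup_(X in F) X) m by apply: sF; rewrite mem_head.
  have [|->|[Z FZ Zs]] := IHs; first by move=> n ns; apply: sF; rewrite inE ns orbT.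
    by exists X => // n; rewrite inE => /eqP->.
  have [XZ|ZX] := Ftot _ _ FX FZ.
    by exists Z => // n; rewrite inE => /predU1P[->|/Zs]; [apply: XZ|].
  by exists X => // n; rewrite inE => /predU1P[->|/Zs/ZX].
have [m|t0|[X FX Xt]] := seqF (msupp t).
- by rewrite -mcoeff_neq0; apply: tF.
- by left; rewrite [t]monalgE t0 big_nil.
- by right; exists X => // m; rewrite mcoeff_neq0; apply: Xt.
Qed.

Lemma maximal_independent_span B : indep B -> (forall C, B `<` C -> ~ indep C) ->
  forall m, exists2 t, supported B t & ev t = m.
Proof.
move=> Bindep Bmax m; have [Bm|nBm] := pselect (B m).
  exists << m >>; last by rewrite /ev mcombU rmorph1 scale1r.
  by move=> n; rewrite mcoeffU; have [<-|_] := eqVneq m n; rewrite ?eqxx.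
(* By maximality there is a nontrivial relation; it involves [m] because [B] is independent, and it
   is solved for [m]. *)
have /Bmax/existsNP[t /not_implyP[tC /not_implyP[et t0]]] : B `<` (B `|` [set m]).
  by split; [move=> n; left|move=> /(_ m) h; apply/nBm/h; right].
have tm0 : t@_m != 0.
  apply/eqP => tm0; apply: t0; apply: Bindep => // n tn; have [//|nm] := tC n tn.
  by rewrite nm tm0 eqxx in tn.
exists (- (t@_m)^-1 *: (t - << t@_m *g m >>)).
  move=> n; rewrite mcoeffZ mcoeffB mcoeffU; have [<-|nm] := eqVneq m n.
    by rewrite subrr mulr0 eqxx.
  rewrite subr0 mulf_eq0 negb_or => /andP[_ /tC[//|mn]].
  by rewrite mn eqxx in nm.
rewrite /ev mcombZ raddfB /= mcombU -/(ev t) et sub0r scalerN rmorphN scaleNr opprK.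
by rewrite scalerA -rmorphM mulVf // rmorph1 scale1r.
Qed.

Lemma basis_exists : exists (I : choiceType) (b : I -> M) (c : M -> {malg K[I]}),
  [/\ forall a u v, c (kappa a *: u + v) = a *: c u + c v,
      forall m, mcomb kappa b (c m) = m & forall i, c (b i) = << i >>].
Proof.
have [B [Bindep Bmax]] := maximal_independent.
have Bspan := maximal_independent_span Bindep Bmax.
pose I : choiceType := {m : M | `[< B m >]}.
pose b (i : I) : M := val i.
(* Extension by zero from [I] to [M]; through it the independence of [B] becomes injectivity of
   [mcomb kappa b], whose inverse is [c]. *)
pose push : {linear {malg K[I]} -> {malg K[M]}} := malg_lift (fun i => << b i >>).
have pushE t i : (push t)@_(b i) = t@_i.
  elim/malg_ind: t => [|s t ps pt|a j]; first by rewrite !raddf0.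
    by rewrite !raddfD /= ps pt.
  by rewrite malgUE linearZ /= malg_liftU !mcoeffZ !mcoeffU (inj_eq val_inj).
have push0 t m : ~ B m -> (push t)@_m = 0.
  move=> nBm; elim/malg_ind: t => [|s t ps pt|a j]; first by rewrite !raddf0.
    by rewrite !raddfD /= ps pt addr0.
  rewrite malgUE linearZ /= malg_liftU !mcoeffZ !mcoeffU.
  by case: eqP => [jm|_]; rewrite ?mulr0 //; case: nBm; rewrite -jm; exact: (asboolW (valP j)).
have ev_push t : ev (push t) = mcomb kappa b t.
  elim/malg_ind: t => [|s t ps pt|a j]; first by rewrite /ev !raddf0.
    by rewrite /ev !raddfD /=; congr (_ + _).
  by rewrite malgUE linearZ /= malg_liftU /ev !mcombZ !mcombU.
have ev_inj : injective (mcomb kappa b).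
  move=> s t /eqP; rewrite -subr_eq0 -(raddfB (mcomb kappa b)) /= -ev_push => /eqP evst.
  have p0 : push (s - t) = 0.
    by apply: Bindep => // m; have [//|/push0->] := pselect (B m); rewrite eqxx.
  by apply/eqP; rewrite -subr_eq0; apply/eqP; apply/malgP => i; rewrite -pushE p0 !mcoeff0.
have ev_surj m : exists t, mcomb kappa b t = m.
  have [t tB <-] := Bspan m.
  exists (\sum_(n <- msupp t) if insub n is Some i then << t@_n *g i >> else 0).
  rewrite raddf_sum /=; apply: eq_big_seq => n; rewrite -mcoeff_neq0 => tn.
  by rewrite insubT => [|Bn]; [apply/asboolP/tB|rewrite mcombU].
have [c cK] := choice ev_surj.
exists I, b, c; split=> // [a u v|i]; apply: ev_inj; rewrite cK.
  by rewrite raddfD /= mcombZ !cK.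
by rewrite mcombU rmorph1 scale1r.
Qed.

End Basis.
End FreeModules.

(** * The Koszul resolution *)

Section KoszulOperators.
Variables (K : fieldType) (g : {poly K}) (A : nzRingType) (D : ore_coords g A).
Local Notation C := (oconst D).
Local Notation x := (C 'X).
Local Notation y := (ovar D).

(* [T] stands for $A \otimes_K M$, with [tau m] $= 1 \otimes m$,
   $R_u (a \otimes m) = a u \otimes m$, $L_u (a \otimes m) = a \otimes u m$ and
   $D_u = R_u - L_u$; [ydeg_lt n] is the submodule of elements of y-degree less
   than [n]. The differentials are $(s_1, s_2) \mapsto D_x s_1 + D_y s_2$ and
   $t \mapsto (D_y t - E t, - D_x t)$, where $D_x E = D_g$. *)
Variables (T : lmodType A) (Rop Lop Dop : A -> {linear T -> T}).
Hypotheses (DopE : forall u t, Dop u t = Rop u t - Lop u t)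
  (RopM : forall u v t, Rop u (Rop v t) = Rop (v * u) t)
  (LopM : forall u v t, Lop u (Lop v t) = Lop (u * v) t)
  (RLopC : forall u v t, Rop u (Lop v t) = Lop v (Rop u t))
  (RopD : forall u v t, Rop (u + v) t = Rop u t + Rop v t)
  (LopD : forall u v t, Lop (u + v) t = Lop u t + Lop v t)
  (RLop_scalar : forall k t, Rop (C k%:P) t = Lop (C k%:P) t).

Variables (M : lmodType A) (tau : {additive M -> T}) (eps : {linear T -> M}).
Hypotheses (Rop_tau : forall u m, Rop u (tau m) = u *: tau m)
  (Lop_tau : forall u m, Lop u (tau m) = tau (u *: m))
  (tauZ : forall k m, tau (C k%:P *: m) = C k%:P *: tau m)
  (eps_tau : forall m, eps (tau m) = m)
  (tau_ind : forall P : T -> Prop, (forall s t, P s -> P t -> P (s + t)) ->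
     (forall a m, P (a *: tau m)) -> forall t, P t).

Variable ydeg_lt : nat -> T -> Prop.
Hypotheses (ydeg_ltD : forall n s t, ydeg_lt n s -> ydeg_lt n t -> ydeg_lt n (s + t))
  (ydeg_ltN : forall n t, ydeg_lt n t -> ydeg_lt n (- t))
  (ydeg_ltW : forall m n t, (m <= n)%N -> ydeg_lt m t -> ydeg_lt n t)
  (ydeg_lt_exists : forall t, exists n, ydeg_lt n t)
  (ydeg_lt0 : forall t, ydeg_lt 0 t <-> t = 0)
  (ydeg_lt_Lop : forall n u t, ydeg_lt n t -> ydeg_lt n (Lop u t))
  (ydeg_lt_RopC : forall n a t, ydeg_lt n t -> ydeg_lt n (Rop (C a) t))
  (ydeg_lt_Ropy : forall n t, ydeg_lt n.+1 (Rop y t) -> ydeg_lt n t)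
  (ydeg_lt_split : forall n s, ydeg_lt n.+1 s -> exists r, ydeg_lt n r /\ ydeg_lt 1 (s - Rop y r))
  (Dop_x_inj : forall t, ydeg_lt 1 t -> Dop x t = 0 -> t = 0).

(** Telescoping: $R_vR_u-L_vL_u=R_v(R_u-L_u)+(R_v-L_v)L_u$, and $R_v$ commutes with $D_v$. *)
Lemma Dop_mul u v (E : {linear T -> T}) : (forall t, Dop v (E t) = Dop u t) ->
  v * u = u * v -> forall t, Dop v (Rop v (E t) + Lop u t) = Dop (u * v) t.
Proof.
move=> DE vu t; rewrite (raddfD (Dop v)) /=.
have -> : Dop v (Rop v (E t)) = Rop v (Dop v (E t)).
  by rewrite DopE (DopE v (E t)) (raddfB (Rop v)) /= RLopC.
by rewrite DE !DopE (raddfB (Rop v)) /= RopM LopM addrA subrK vu.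
Qed.

Lemma Dop_add_scalar u k t : Dop (u + C k%:P) t = Dop u t.
Proof. by rewrite !DopE RopD LopD RLop_scalar opprD addrACA subrr addr0. Qed.

(** [E] is the divided difference of [a] at $R_x$ and $L_x$, built by Horner's rule
    $E_{aX+k}=R_xE_a+L_a$. *)
Lemma Dop_quotient (a : {poly K}) : exists E : {linear T -> T},
  (forall t, Dop x (E t) = Dop (C a) t) /\ (forall n t, ydeg_lt n t -> ydeg_lt n (E t)).
Proof.
elim/poly_ind: a => [|a k [E [DE dE]]].
  exists \0; split=> [t|n t _]; last by apply: (ydeg_ltW (leq0n n)); apply/ydeg_lt0.
  by rewrite (raddf0 (Dop x)) -polyC0 DopE RLop_scalar subrr.
exists ((Rop x \o E) \+ Lop (C a)); split=> [t|n t dt]; last first.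
  by apply: ydeg_ltD; [apply/ydeg_lt_RopC/dE|apply: ydeg_lt_Lop].
have ax : x * C a = C a * x by rewrite -!rmorphM mulrC.
by rewrite rmorphD rmorphM Dop_add_scalar -(Dop_mul DE ax).
Qed.

Lemma Dop_Dop u v t : Dop u (Dop v t) =
  Rop (v * u) t + Lop (u * v) t - (Rop u (Lop v t) + Rop v (Lop u t)).
Proof.
rewrite !DopE (raddfB (Rop u)) (raddfB (Lop u)) /= RopM LopM -(RLopC v u) opprB [in RHS]opprD.
by rewrite addrACA.
Qed.

(** The mixed terms cancel because each $R_u$ commutes with each $L_v$. As $R$ reverses products and
    $L$ preserves them, $[R_x,R_y]=R_g$ and $[L_x,L_y]=-L_g$. *)
Lemma Dop_commutator t : Dop x (Dop y t) - Dop y (Dop x t) = Dop (C g) t.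
Proof.
have yx : y * x = x * y + C g by rewrite ovarC derivX mulr1.
rewrite !Dop_Dop [Rop y (Lop x t) + _]addrC opprB addrA subrK yx RopD LopD DopE.
by rewrite [X in _ - X]addrA [X in X - _]addrAC opprD addrACA subrr add0r.
Qed.

Lemma ydeg_ltB n s t : ydeg_lt n s -> ydeg_lt n t -> ydeg_lt n (s - t).
Proof. by move=> ds dt; apply: ydeg_ltD => //; apply: ydeg_ltN. Qed.

(** In $R_ys_2=L_ys_2-D_xs_1$ the left side has larger y-degree than the right unless $s_2=0$; then
    $D_x$ is injective on y-degree 0. *)
Lemma koszul_exact1_base s1 s2 :
  ydeg_lt 1 s1 -> Dop x s1 + Dop y s2 = 0 -> s1 = 0 /\ s2 = 0.
Proof.
move=> ds Ds; suff s20 : s2 = 0.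
  by split=> //; apply: Dop_x_inj => //; rewrite s20 raddf0 addr0 in Ds.
have Ry : Rop y s2 = Lop y s2 - Dop x s1.
  by move/eqP: Ds; rewrite [Dop y _]DopE addrA subr_eq0 => /eqP<-; rewrite addrAC subrr add0r.
have [n] := ydeg_lt_exists s2; elim: n => [|n IHn] ds2; first exact/ydeg_lt0.
apply/IHn/ydeg_lt_Ropy; rewrite Ry; apply: ydeg_ltB; first exact: ydeg_lt_Lop.
apply: (@ydeg_ltW 1) => //; rewrite DopE.
by apply: ydeg_ltB; [apply: ydeg_lt_RopC|apply: ydeg_lt_Lop].
Qed.

Lemma koszul_exact1 (E : {linear T -> T}) s1 s2 :
  (forall t, Dop x (E t) = Dop (C g) t) -> (forall n t, ydeg_lt n t -> ydeg_lt n (E t)) ->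
  Dop x s1 + Dop y s2 = 0 -> exists r, s1 = Dop y r - E r /\ s2 = - Dop x r.
Proof.
move=> DE dE.
have IH1 u1 u2 : ydeg_lt 1 u1 -> Dop x u1 + Dop y u2 = 0 ->
    exists r, u1 = Dop y r - E r /\ u2 = - Dop x r.
  by move=> du /(koszul_exact1_base du)[-> ->]; exists 0; rewrite !raddf0 ?addr0.
have [n] := ydeg_lt_exists s1.
elim: n s1 s2 => [|n IHn] s1 s2 ds Ds.
  by apply: IH1 Ds; apply: ydeg_ltW ds.
have [r [dr dsr]] := ydeg_lt_split ds; case: n => [|n] in IHn ds dr dsr *; first exact: IH1 ds Ds.
(* Subtracting the boundary of [r] cancels the part $R_yr$ of [s1]; the new terms $L_yr$ and $Er$
   have no larger y-degree than [r], so the bound drops by one. *)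
pose s1' := s1 - (Dop y r - E r); pose s2' := s2 + Dop x r.
have ds' : ydeg_lt n.+1 s1'.
  have -> : s1' = s1 - Rop y r + (Lop y r + E r).
    by rewrite /s1' DopE opprD opprK opprB addrA [s1 + (_ - _)]addrA [s1 + _ - _]addrAC -addrA.
  by apply: ydeg_ltD; [apply: ydeg_ltW dsr|apply: ydeg_ltD; [apply: ydeg_lt_Lop|apply: dE]].
have [|r' [s1E s2E]] := IHn s1' s2' ds'.
  rewrite /s1' /s2' (raddfB (Dop x)) (raddfD (Dop y)) /= addrACA Ds add0r.
  by rewrite (raddfB (Dop x)) /= DE -Dop_commutator opprB [_ - _ - _]addrAC subrr add0r addNr.
exists (r + r'); split.
  by rewrite (raddfD (Dop y)) (raddfD E) /= opprD addrACA -s1E /s1' addrC subrK.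
by rewrite (raddfD (Dop x)) /= opprD -s2E /s2' addrC addrK.
Qed.

(** The equation reads $R_yt=Et+L_yt$, where only $R_y$ raises the y-degree. *)
Lemma koszul_exact2 (E : {linear T -> T}) t :
  (forall n t, ydeg_lt n t -> ydeg_lt n (E t)) -> Dop y t = E t -> t = 0.
Proof.
move=> dE /eqP; rewrite DopE subr_eq => /eqP Ry.
have [n] := ydeg_lt_exists t; elim: n => [|n IHn] dt; first exact/ydeg_lt0.
by apply/IHn/ydeg_lt_Ropy; rewrite Ry; apply: ydeg_ltD; [apply: dE|apply: ydeg_lt_Lop].
Qed.

(** Modulo the image, $a\otimes m\equiv1\otimes am$: this holds for $a=x$, $a=y$ and scalars, and
    passes to sums and products. Hence every [t] is congruent to [tau (eps t)]. *)
Lemma koszul_exact0 t : eps t = 0 -> exists s1 s2, t = Dop x s1 + Dop y s2.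
Proof.
pose im t := exists s1 s2, t = Dop x s1 + Dop y s2.
have im0 : im 0 by exists 0, 0; rewrite (raddf0 (Dop x)) (raddf0 (Dop y)) addr0.
have imD u v : im u -> im v -> im (u + v).
  move=> [u1 [u2 ->]] [v1 [v2 ->]]; exists (u1 + v1), (u2 + v2).
  by rewrite (raddfD (Dop x)) (raddfD (Dop y)) addrACA.
have imZ a u : im u -> im (a *: u).
  move=> [u1 [u2 ->]]; exists (a *: u1), (a *: u2).
  by rewrite (linearZ_LR (Dop x)) (linearZ_LR (Dop y)) scalerDr.
pose Q a := forall m, im (a *: tau m - tau (a *: m)).
have QD p q : Q p -> Q q -> Q (p + q).
  move=> Qp Qq m; rewrite !scalerDl (raddfD tau) opprD addrACA.
  exact: imD.
have QM p u : Q p -> (forall m, im (u *: tau m - tau (u *: m))) -> Q (p * u).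
  move=> Qp Qu m.
  have -> : (p * u) *: tau m - tau ((p * u) *: m) =
      p *: (u *: tau m - tau (u *: m)) + (p *: tau (u *: m) - tau (p *: (u *: m))).
    by rewrite (scalerBr p) !scalerA addrA subrK.
  by apply: imD; [apply/imZ/Qu|apply: Qp].
have Qx : Q x by move=> m; exists (tau m), 0; rewrite (raddf0 (Dop y)) addr0 DopE Rop_tau Lop_tau.
have Qy : Q y by move=> m; exists 0, (tau m); rewrite (raddf0 (Dop x)) add0r DopE Rop_tau Lop_tau.
have Qk k : Q (C k%:P) by move=> m; rewrite tauZ subrr.
have QC a : Q (C a).
  elim/poly_ind: a => [|a k Qa]; first by rewrite -polyC0.
  by rewrite rmorphD rmorphM; apply: QD; [apply: QM|apply: Qk].
have QA p : Q p.
  elim/(@ore_coords_ind _ _ _ D): p => [|p q|a i]; [by rewrite -(rmorph0 C) -polyC0|exact: QD|].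
  by elim: i => [|i IHi]; rewrite ?mulr1 // exprSr mulrA; apply: QM.
move=> et; suff : im (t - tau (eps t)) by rewrite et (raddf0 tau) subr0.
elim/tau_ind: t {et} => [s t ims imt|a m].
- by rewrite (raddfD eps) (raddfD tau) opprD addrACA; apply: imD.
- by rewrite (linearZ_LR eps) eps_tau; apply: QA.
Qed.

Lemma koszul_pdim_le2 : projective T -> pdim_le M 2.
Proof.
move=> projT; have [E [DE dE]] := Dop_quotient g.
pose d1f (z : T * T) := Dop x z.1 + Dop y z.2.
have d1L : linear d1f by move=> a u v; rewrite /d1f !linearP scalerDr addrACA.
pose d1 := HB.pack_for {linear (T * T)%type -> T} d1f (GRing.isLinear.Build _ _ _ _ d1f d1L).
pose d2f t : T * T := (Dop y t - E t, - Dop x t).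
have d2L : linear d2f.
  move=> a u v; rewrite /d2f (linearP (Dop y)) (linearP E) (linearP (Dop x)); congr (_, _) => /=.
    by rewrite opprD addrACA scalerBr.
  by rewrite opprD scalerN.
pose d2 := HB.pack_for {linear T -> (T * T)%type} d2f (GRing.isLinear.Build _ _ _ _ d2f d2L).
(* ['rV[A]_0], the rows of length 0, serves as the zero module. *)
pose P i : lmodType A := match i with
  | 0 => T | 1 => (T * T)%type | 2 => T | _ => 'rV[A]_0 end.
pose d i : {linear P i.+1 -> P i} := match i return {linear P i.+1 -> P i} with
  | 0 => d1 | 1 => d2 | 2 => \0 | _ => \0 end.
have P0 i : (2 < i)%N -> forall u : P i, u = 0.
  by case: i => [|[|[|i]]] // _ u; apply: thinmx0.
exists P, d, eps; split=> //.
- case=> [|[|[|i]]]; last by apply: projective_trivial; apply: P0.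
  + exact: projT.
  + by apply: projective_pair.
  + exact: projT.
- by apply/seteqP; split=> // m _; exists (tau m); rewrite ?eps_tau.
- apply/seteqP; split=> [_ [[s1 s2] _ <-]|t /= /koszul_exact0[s1 [s2 ->]]]; last by exists (s1, s2).
  have eD u t : eps (Dop u t) = 0.
    elim/tau_ind: t => [s t es et|a m].
      by rewrite (raddfD (Dop u)) (raddfD eps) /= es et addr0.
    rewrite (linearZ_LR (Dop u)) (linearZ_LR eps) /= DopE Rop_tau Lop_tau.
    by rewrite (raddfB eps) /= (linearZ_LR eps) /= !eps_tau subrr scaler0.
  by rewrite /= /d1f (raddfD eps) /= !eD addr0.
case=> [|[|i]]; apply/seteqP; split.
- move=> _ [t _ <-]; rewrite /= /d1f /d2f /= (raddfB (Dop x)) (raddfN (Dop y)) /= DE.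
  by rewrite -Dop_commutator opprB addrCA subrr addr0 subrr.
- move=> [s1 s2] /= /(koszul_exact1 DE dE)[r [s1E s2E]]; exists r => //=.
  by move: s1E s2E => /= -> ->.
- by move=> _ [t _ <-]; apply: (raddf0 d2).
- move=> t /= [/eqP]; rewrite subr_eq0 => /eqP Dt _; exists 0 => //=.
  by rewrite (koszul_exact2 dE Dt).
- by move=> _ [t _ <-]; case: (i).
- by move=> t _; exists 0 => //; rewrite [t](P0 i.+3) // (raddf0 (d i.+3)).
Qed.

End KoszulOperators.

(** * The operators on the free module spanned by a K-basis of M *)

Section KoszulResolution.
Variables (K : fieldType) (g : {poly K}) (A : nzRingType) (D : ore_coords g A).
Local Notation C := (oconst D).
Local Notation x := (C 'X).
Local Notation y := (ovar D).
Local Notation cf := (ocf D).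

Lemma ocfN p : cf (- p) = - cf p. Proof. exact: raddfN. Qed.
Lemma ocfD p q : cf (p + q) = cf p + cf q. Proof. exact: raddfD. Qed.

Let kappa : {rmorphism K -> A} := C \o polyC.

(** Scalars have derivative zero, hence commute with [y]. Their centrality gives [Rop] and [Lop] the
    expected values on every [tau m], not only on basis vectors. *)
Lemma oconst_scalarC p k : kappa k * p = p * kappa k.
Proof.
elim/(@ore_coords_ind _ _ _ D): p => [|p q kp kq|a i]; rewrite ?mulr0 ?mul0r //.
  by rewrite mulrDr mulrDl kp kq.
have ky : GRing.comm (kappa k) (y ^+ i).
  by apply: commrX; apply: commr_sym; rewrite /GRing.comm /= ovarC derivC mulr0 rmorph0 addr0.
by rewrite mulrA [kappa k * _](_ : _ = C a * kappa k) -?mulrA ?ky //= -!rmorphM mulrC.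
Qed.

Lemma ocfMy p : cf (p * y) = cf p * 'X.
Proof.
elim/(@ore_coords_ind _ _ _ D): p => [|p q py qy|a i]; first by rewrite mul0r raddf0 mul0r.
  by rewrite mulrDl !raddfD /= py qy mulrDl.
by rewrite -mulrA -exprSr !ocfZ !ocfYXn exprSr scalerAl.
Qed.

Lemma size_ocfY_leq p : (size (cf (y * p)) <= (size (cf p)).+1)%N.
Proof.
have [->|p0] := eqVneq p 0; first by rewrite mulr0 raddf0 size_poly0.
by rewrite size_ocfY.
Qed.

Lemma size_ocfMC p a : (size (cf (p * C a)) <= size (cf p))%N.
Proof.
rewrite [X in cf (X * _)](ore_coordsE D) mulr_suml raddf_sum /=.
apply: (leq_trans (size_sum _ _ _)); apply/bigmax_leqP => i _.
rewrite -mulrA ocfZ (leq_trans (size_scale_leq _ _)) //.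
apply: leq_trans (ltn_ord i); elim: (i : nat) => [|j IHj].
  by rewrite expr0 mul1r ocfC size_polyC_leq1.
by rewrite exprS -mulrA (leq_trans (size_ocfY_leq _)).
Qed.

Lemma ocf_surj q : exists p, cf p = q.
Proof.
exists (\sum_(i < size q) C q`_i * y ^+ i); rewrite raddf_sum -[RHS]coefK poly_def.
by apply: eq_bigr => i _; rewrite /= ocfZ ocfYXn.
Qed.

Variables (M : lmodType A) (I : choiceType) (b : I -> M) (c : M -> {malg K[I]}).
Hypotheses (c_linear : forall k u v, c (kappa k *: u + v) = k *: c u + c v)
  (cK : forall m, mcomb kappa b (c m) = m) (cb : forall i, c (b i) = << i >>).

Local Notation T := {malg A[I]}.

Definition tau (m : M) : T := mcomb kappa (fun i => << i >>) (c m).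

Lemma tau_b i : tau (b i) = << i >>.
Proof. by rewrite /tau cb mcombU rmorph1 scale1r. Qed.

Lemma tau_linear k u v : tau (kappa k *: u + v) = kappa k *: tau u + tau v.
Proof. by rewrite /tau c_linear raddfD /= mcombZ. Qed.

Fact tau_is_zmod_morphism : zmod_morphism tau.
Proof.
by move=> u v; rewrite -[u - v]addrC -scaleN1r -(rmorph1 kappa) -rmorphN tau_linear
  rmorphN rmorph1 scaleN1r addrC.
Qed.
HB.instance Definition _ := GRing.isZmodMorphism.Build _ _ tau tau_is_zmod_morphism.

Lemma tauZ k m : tau (kappa k *: m) = kappa k *: tau m.
Proof. by rewrite -[_ *: m]addr0 tau_linear raddf0 addr0. Qed.

(** Universal property of $A\otimes_KM$: a K-linear map out of [M] extends A-linearly. *)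
Lemma tau_lift (V : lmodType A) (h : {additive M -> V}) :
  (forall k m, h (kappa k *: m) = kappa k *: h m) ->
  forall m, malg_lift (h \o b) (tau m) = h m.
Proof.
move=> hZ m; rewrite -[in RHS](cK m) /tau.
elim/malg_ind: (c m) => [|s t hs ht|a i]; first by rewrite !raddf0.
  by rewrite !raddfD /= hs ht.
by rewrite !mcombU linearZ /= malg_liftU hZ.
Qed.

Lemma coef_tau m i : (tau m)@_i = kappa (c m)@_i.
Proof.
rewrite /tau; elim/malg_ind: (c m) => [|s t hs ht|a j]; first by rewrite !raddf0.
  by rewrite !raddfD /= hs ht.
by rewrite mcombU mcoeffZ !mcoeffU; case: eqP; rewrite ?mulr1 ?mulr0 ?rmorph0.
Qed.

Lemma tau_gen (V : lmodType A) (u v : {linear T -> V}) :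
  (forall m, u (tau m) = v (tau m)) -> u =1 v.
Proof. by move=> uv; apply: malg_linear_eq => i; rewrite -tau_b. Qed.

Definition eps : {linear T -> M} := malg_lift b.

Lemma eps_tau m : eps (tau m) = m.
Proof. exact: (@tau_lift M idfun). Qed.

Definition Rop u : {linear T -> T} := malg_lift (fun i => u *: << i >>).
Definition Lop u : {linear T -> T} := malg_lift (fun i => tau (u *: b i)).

Lemma Rop_tau u m : Rop u (tau m) = u *: tau m.
Proof.
rewrite /tau; elim/malg_ind: (c m) => [|s t hs ht|a j].
- by rewrite !raddf0 ?scaler0.
- by rewrite !raddfD /= hs ht ?scalerDr.
by rewrite mcombU linearZ /= malg_liftU !scalerA oconst_scalarC.
Qed.

Lemma Lop_tau u m : Lop u (tau m) = tau (u *: m).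
Proof.
apply: (@tau_lift T (tau \o *:%R u)) => k n /=.
by rewrite scalerA -oconst_scalarC -scalerA tauZ.
Qed.

Lemma RopM u v t : Rop u (Rop v t) = Rop (v * u) t.
Proof.
move: t; apply: (@tau_gen _ (Rop u \o Rop v)) => m /=.
by rewrite !Rop_tau linearZ /= Rop_tau scalerA.
Qed.

Lemma LopM u v t : Lop u (Lop v t) = Lop (u * v) t.
Proof.
move: t; apply: (@tau_gen _ (Lop u \o Lop v)) => m /=.
by rewrite !Lop_tau scalerA.
Qed.

Lemma RLopC u v t : Rop u (Lop v t) = Lop v (Rop u t).
Proof.
move: t; apply: (@tau_gen _ (Rop u \o Lop v) (Lop v \o Rop u)) => m /=.
by rewrite Lop_tau !Rop_tau linearZ /= Lop_tau.
Qed.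

Lemma RopD u v t : Rop (u + v) t = Rop u t + Rop v t.
Proof.
move: t; apply: (@tau_gen _ _ (Rop u \+ Rop v)) => m /=.
by rewrite !Rop_tau scalerDl.
Qed.

Lemma LopD u v t : Lop (u + v) t = Lop u t + Lop v t.
Proof.
move: t; apply: (@tau_gen _ _ (Lop u \+ Lop v)) => m /=.
by rewrite !Lop_tau scalerDl raddfD.
Qed.

Lemma RLop_scalar k t : Rop (kappa k) t = Lop (kappa k) t.
Proof. by move: t; apply: tau_gen => m; rewrite Rop_tau Lop_tau tauZ. Qed.

Definition Dop u : {linear T -> T} := Rop u \- Lop u.

Lemma DopE u t : Dop u t = Rop u t - Lop u t. Proof. by []. Qed.

Lemma coef_Rop u t i : (Rop u t)@_i = t@_i * u.
Proof.
elim/malg_ind: t => [|s t hs ht|a j]; first by rewrite !raddf0 mul0r.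
  by rewrite !raddfD /= hs ht mulrDl.
rewrite malgUE linearZ /= malg_liftU !mcoeffZ !mcoeffU.
by case: eqP; rewrite ?mulr1 // !mulr0 mul0r.
Qed.

(** [tau] has coefficients in [K], so those of [Lop u t] are K-linear combinations of those of [t];
    in particular no degree grows. *)
Lemma Lop_closed (P : A -> Prop) u t : P 0 -> (forall p q, P p -> P q -> P (p + q)) ->
  (forall p k, P p -> P (kappa k * p)) ->
  (forall i, P t@_i) -> forall i, P (Lop u t)@_i.
Proof.
move=> P0 PD PZ Pt i; rewrite /Lop /= /malg_lift /mcomb raddf_sum /=.
elim/big_ind: _ => // j _; rewrite mcoeffZ coef_tau -oconst_scalarC.
exact/PZ/Pt.
Qed.

Definition ydeg_lt n (t : T) := forall i, (size (cf t@_i) <= n)%N.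

Lemma ydeg_ltD n s t : ydeg_lt n s -> ydeg_lt n t -> ydeg_lt n (s + t).
Proof.
move=> ds dt i; rewrite mcoeffD ocfD (leq_trans (size_polyD _ _)) //.
by rewrite geq_max ds dt.
Qed.

Lemma ydeg_ltW m n t : (m <= n)%N -> ydeg_lt m t -> ydeg_lt n t.
Proof. by move=> lemn dt i; apply: leq_trans (dt i) lemn. Qed.

Lemma ydeg_lt_exists t : exists n, ydeg_lt n t.
Proof.
elim/malg_ind: t => [|s t [m ds] [n dt]|a i].
- by exists 0%N => i; rewrite mcoeff0 (raddf0 cf) size_poly0.
- exists (maxn m n); apply: ydeg_ltD; [apply: ydeg_ltW ds|apply: ydeg_ltW dt].
    exact: leq_maxl.
  exact: leq_maxr.
exists (size (cf a)) => j; rewrite mcoeffU; case: eqP => // _.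
by rewrite raddf0 size_poly0.
Qed.

Lemma ydeg_ltN n t : ydeg_lt n t -> ydeg_lt n (- t).
Proof. by move=> dt i; rewrite mcoeffN ocfN size_polyN; apply: dt. Qed.

Lemma ydeg_lt0 t : ydeg_lt 0 t <-> t = 0.
Proof.
split=> [dt|-> i]; last by rewrite mcoeff0 (raddf0 cf) size_poly0.
apply/malgP => i; apply/eqP; have := dt i.
by rewrite leqn0 size_poly_eq0 ocf_eq0 mcoeff0.
Qed.

Lemma ydeg_lt_Lop n u t : ydeg_lt n t -> ydeg_lt n (Lop u t).
Proof.
apply: (Lop_closed (P := fun p => (size (cf p) <= n)%N)).
- by rewrite raddf0 size_poly0.
- by move=> p q dp dq; rewrite raddfD (leq_trans (size_polyD _ _)) // geq_max dp dq.
- by move=> p k dp; rewrite ocfZ (leq_trans (size_scale_leq _ _)).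
Qed.

Lemma ydeg_lt_RopC n a t : ydeg_lt n t -> ydeg_lt n (Rop (C a) t).
Proof. by move=> dt i; rewrite coef_Rop (leq_trans (size_ocfMC _ _)). Qed.

Lemma ydeg_lt_Ropy n t : ydeg_lt n.+1 (Rop y t) -> ydeg_lt n t.
Proof.
move=> dt i; have := dt i; rewrite coef_Rop ocfMy.
have [->|p0] := eqVneq (cf t@_i) 0; first by rewrite size_poly0.
by rewrite size_mulX.
Qed.

Lemma ydeg_lt_split n s : ydeg_lt n.+1 s -> exists r, ydeg_lt n r /\ ydeg_lt 1 (s - Rop y r).
Proof.
(* Dropping the constant coefficient is right division by [y]; [q 0 = 0] keeps [r] zero off the
   support of [s]. *)
move=> ds; have [q qE] := choice (fun p => ocf_surj (drop_poly 1 (cf p))).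
have q0 : q 0 = 0.
  by apply: (@ocf_inj _ _ _ D); rewrite qE !raddf0 ?drop_poly0r.
pose r : T := [malg i in msupp s => q s@_i].
have rE i : r@_i = q s@_i.
  by rewrite mcoeffE; case: ifP => // /negbT/mcoeff_outdom->.
exists r; split=> i.
  by rewrite rE qE size_drop_poly leq_subLR add1n.
rewrite mcoeffB coef_Rop rE ocfB ocfMy qE -[X in X - _](poly_take_drop 1).
by rewrite expr1 addrK size_take_poly.
Qed.

(** The coefficients of [t] lie in $K[x]$ and $R_xt=L_xt$. $R_x$ raises the degree of each nonzero
    coefficient, while $L_x$ does not raise their maximum. *)
Lemma Dop_x_inj t : ydeg_lt 1 t -> Dop x t = 0 -> t = 0.
Proof.
move=> dt /eqP; rewrite DopE subr_eq0 => /eqP Dt.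
have tC i : t@_i = C (cf t@_i)`_0.
  by apply: (@ocf_inj _ _ _ D); rewrite ocfC; apply: size1_polyC.
suff t0 (n : nat) : (forall i, (size ((cf t@_i)`_0)%R <= n)%N) -> t = 0.
  have [n tn] : exists n, forall i, (size ((cf t@_i)`_0)%R <= n)%N.
    exists (\max_(i <- msupp t) size ((cf t@_i)`_0)%R) => i.
    have [it|/mcoeff_outdom->] := boolP (i \in msupp t); first exact: leq_bigmax_seq.
    by rewrite raddf0 coef0 size_poly0.
  exact: t0 tn.
elim: n => [|n IHn] tn.
  apply/malgP => i; rewrite tC mcoeff0; have := tn i.
  by rewrite leqn0 size_poly_eq0 => /eqP->; rewrite rmorph0.
apply: IHn => i.
have : (size ((cf (Lop x t)@_i)`_0)%R <= n.+1)%N.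
  apply: (Lop_closed (P := fun p => (size ((cf p)`_0)%R <= n.+1)%N)) => //.
  - by rewrite raddf0 coef0 size_poly0.
  - by move=> p q dp dq; rewrite raddfD coefD (leq_trans (size_polyD _ _)) // geq_max dp dq.
  - by move=> p k dp; rewrite ocfZ coefZ mul_polyC (leq_trans (size_scale_leq _ _)).
have -> : (cf (Lop x t)@_i)`_0 = (cf t@_i)`_0 * 'X.
  by rewrite -Dt coef_Rop {1}tC -rmorphM ocfC coefC.
have [->|p0] := eqVneq (cf t@_i)`_0 0; first by rewrite size_poly0.
by rewrite size_mulX.
Qed.

Lemma koszul_resolution : pdim_le M 2.
Proof.
have tau_ind (P : T -> Prop) : (forall s t, P s -> P t -> P (s + t)) ->
    (forall a m, P (a *: tau m)) -> forall t, P t.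
  move=> PD Pt; elim/malg_ind => // [|a i]; last by rewrite malgUE -tau_b.
  by rewrite -(scale0r (tau 0)).
exact: (koszul_pdim_le2 DopE RopM LopM RLopC RopD LopD RLop_scalar Rop_tau Lop_tau tauZ
  eps_tau tau_ind ydeg_ltD ydeg_ltN ydeg_ltW ydeg_lt_exists ydeg_lt0
  ydeg_lt_Lop ydeg_lt_RopC ydeg_lt_Ropy ydeg_lt_split Dop_x_inj
  (projective_malg (I := I))).
Qed.

End KoszulResolution.

Lemma ore_lgldim_le2 (K : fieldType) (g : {poly K}) (A : nzRingType) (D : ore_coords g A) :
  lgldim_le A 2.
Proof.
move=> M; have [I [b [c [c_linear cK cb]]]] := basis_exists (oconst D \o polyC) M.
exact: koszul_resolution c_linear cK cb.
Qed.

(** * Submodules, quotients and the lower bound *)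

Section SubmoduleQuotient.
Variables (R : nzRingType) (V : lmodType R) (N : set V) (NS : submodules V N).

(** The closure proof is an argument so that the submodule structure can be inferred from the
    predicate. *)
Definition submod_pred of submodules V N : {pred V} := fun v => `[< N v >].

Lemma submod_predE v : (v \in submod_pred NS) = `[< N v >]. Proof. by []. Qed.

Fact submod_pred_closed : submod_closed (submod_pred NS).
Proof.
have [N0 NP] := (submodulesP N).1 NS.
split=> [|a u v]; first exact/asboolP.
by rewrite !submod_predE => /asboolP Nu /asboolP Nv; apply/asboolP/NP.
Qed.
HB.instance Definition _ := GRing.isSubmodClosed.Build R V (submod_pred NS)
  (GRing.submod_closed_semi submod_pred_closed).

Definition submod := {v : V | v \in submod_pred NS}.
HB.instance Definition _ := Choice.on submod.
HB.instance Definition _ := SubType.on submod.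
HB.instance Definition _ := [SubChoice_isSubLmodule of submod by <:].

Definition quotmod := Quotient.quot (submod_pred NS).
HB.instance Definition _ := GRing.Zmodule.on quotmod.

Definition quotmod_pi (v : V) : quotmod := \pi_(Quotient.quot (submod_pred NS))%qT v.

Lemma quotmod_pi_eq u v : (quotmod_pi u = quotmod_pi v) <-> N (u - v).
Proof.
rewrite /quotmod_pi; split=> [/eqP|Nuv].
  by rewrite -Quotient.idealrBE => /asboolP.
by apply/eqP; rewrite -Quotient.idealrBE; apply/asboolP.
Qed.

Lemma quotmod_pi_surj q : exists v, quotmod_pi v = q.
Proof. by exists (repr q); apply: reprK. Qed.

Definition quotmod_scale a (q : quotmod) : quotmod :=
  quotmod_pi (a *: repr (q : Quotient.quot (submod_pred NS))).

Fact quotmod_scaleE a v : quotmod_scale a (quotmod_pi v) = quotmod_pi (a *: v).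
Proof.
apply/quotmod_pi_eq; rewrite -scalerBr; have [N0 NP] := (submodulesP N).1 NS.
rewrite -[_ *: _]addr0; apply: NP => //; apply/quotmod_pi_eq.
exact: reprK.
Qed.

Fact quotmod_scaleA a a' q : quotmod_scale a (quotmod_scale a' q) = quotmod_scale (a * a') q.
Proof. by have [v <-] := quotmod_pi_surj q; rewrite !quotmod_scaleE scalerA. Qed.
Fact quotmod_scale1 : left_id 1 quotmod_scale.
Proof. by move=> q; have [v <-] := quotmod_pi_surj q; rewrite quotmod_scaleE scale1r. Qed.
Fact quotmod_piD u v : quotmod_pi (u + v) = quotmod_pi u + quotmod_pi v.
Proof. exact: (raddfD \pi_(Quotient.quot (submod_pred NS))%qT). Qed.
Fact quotmod_scaleDr : right_distributive quotmod_scale +%R.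
Proof.
move=> a q r; have [v <-] := quotmod_pi_surj q; have [w <-] := quotmod_pi_surj r.
by rewrite -quotmod_piD !quotmod_scaleE -quotmod_piD scalerDr.
Qed.
Fact quotmod_scaleDl q : {morph quotmod_scale^~ q : a a' / a + a'}.
Proof.
move=> a a'; have [v <-] := quotmod_pi_surj q.
by rewrite !quotmod_scaleE -quotmod_piD scalerDl.
Qed.
HB.instance Definition _ := GRing.Zmodule_isLmodule.Build R quotmod
  quotmod_scaleA quotmod_scale1 quotmod_scaleDr quotmod_scaleDl.

Fact quotmod_pi_linear : linear quotmod_pi.
Proof. by move=> a u v; rewrite quotmod_piD -quotmod_scaleE. Qed.
HB.instance Definition _ := GRing.isLinear.Build R V quotmod _ quotmod_pi quotmod_pi_linear.

End SubmoduleQuotient.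

(** * Lower bound for the global dimension *)

Section LowerBound.
Variables (K : fieldType) (g : {poly K}) (A : nzRingType) (D : ore_coords g A).
Local Notation C := (oconst D).
Local Notation y := (ovar D).
Local Notation cf := (ocf D).
Hypothesis g_nonconst : (1 < size g)%N.

Definition ore_gy : set A^o := [set p | exists a b : A, p = a * C g + b * y].

Lemma ore_gy_submodules : submodules A^o ore_gy.
Proof.
apply/submodulesP; split=> [|a u v [u1 [u2 ->]] [v1 [v2 ->]]].
  by exists 0, 0; rewrite !mul0r addr0.
exists (a * u1 + v1), (a * u2 + v2).
by rewrite /GRing.scale /= mulrDr !mulrDl !mulrA addrACA.
Qed.

(** The elements whose constant coefficient is divisible by [g] form a left ideal containing [g] and
    [y] but not 1. *)
Lemma ore_gy_proper : ~ ore_gy 1.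
Proof.
pose N (p : A^o) := g %| (cf p)`_0.
have NZ (a p : A) : N p -> N (a * p).
  apply: (@ore_scale_closed _ _ _ D A^o N) => [|u v|b u|u]; rewrite /N.
  - by rewrite raddf0 coef0 dvdp0.
  - by rewrite ocfD coefD; apply: dvdp_add.
  - by rewrite ocfZ coefZ; apply: dvdp_mull.
  by move=> _; rewrite coef_ocfY add0r dvdp_mulr.
move=> [a [b e1]]; have : N 1.
  rewrite e1 /N ocfD coefD; apply: dvdp_add; apply: NZ; rewrite /N.
    by rewrite ocfC coefC.
  by rewrite -[y]expr1 ocfYXn coefX dvdp0.
rewrite /N ocf1 coefC eqxx dvdp1 => /eqP sz.
by have := g_nonconst; rewrite sz.
Qed.

Lemma ore_twist : (y - C g^`()) * C g = C g * y.
Proof. by rewrite mulrBl ovarC -rmorphM [g^`() * g]mulrC addrK. Qed.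

(* Modulo the normal element [g] the ring is [K[x]/(g)[y]], in which
   [y - g^`()] is monic, hence regular. *)
Lemma ore_twist_regular u v : (y - C g^`()) * u = C g * v -> exists u', u = C g * u'.
Proof.
move=> uv.
(* Descending induction on [k]: comparing coefficients of degree [k.+1] expresses $u_k$ modulo [g]
   as $g'u_{k+1}$. *)
have dvd m k : (size (cf u) <= k + m)%N -> g %| (cf u)`_k.
  elim: m k => [|m IHm] k szu; first by rewrite nth_default ?dvdp0 // -[k]addn0.
  have := congr1 (fun p => (cf p)`_k.+1) uv.
  rewrite mulrBl ocfB !ocfZ coefB coef_ocfY !coefZ /= => /eqP; rewrite subr_eq => /eqP ukE.
  have -> : (cf u)`_k = g * (cf v)`_k.+1 + g^`() * (cf u)`_k.+1 - g * ((cf u)`_k.+1)^`().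
    by rewrite -ukE addrK.
  apply: dvdp_sub; last exact: dvdp_mulr.
  apply: dvdp_add; first exact: dvdp_mulr.
  by apply/dvdp_mull/IHm; rewrite addSnnS.
have [u' u'E] := ocf_surj D (map_poly (fun a => a %/ g) (cf u)).
exists u'; apply: (@ocf_inj _ _ _ D); rewrite ocfZ u'E; apply/polyP => k.
rewrite coefZ coef_map_id0 ?div0p // mulrC divpK //.
by apply: (dvd (size (cf u))); rewrite leq_addl.
Qed.

Lemma oconst_lreg u v : C g * u = C g * v -> u = v.
Proof.
move=> /(congr1 cf); rewrite !ocfZ => /polyP uv; apply: (@ocf_inj _ _ _ D).
apply/polyP => k; have := uv k; rewrite !coefZ; apply: mulfI.
by rewrite -size_poly_gt0 ltnW.
Qed.

Local Notation Q := (quotmod ore_gy_submodules).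
Local Notation J := (submod ore_gy_submodules).

(** If [m <= 1], the kernel of [e] is projective, and comparing it with the kernel [J] of [pi] lifts
    the generators [g], [y] of [J] to [u], [v] in $A^2$ with $(y-g')u=gv$. So [u] is divisible by
    [g], and cancelling [g] writes 1 as an element of [J]. *)
Lemma ore_pdim_ge2 m : pdim_le (Q : lmodType A) m -> (2 <= m)%N.
Proof.
case=> P [d [e [projP P0 e_surj d0_range d_range]]]; rewrite ltnNge; apply/negP => lem1.
pose pi : {linear A^o -> Q} := quotmod_pi ore_gy_submodules.
have pi0 (p : A^o) : pi p = 0 <-> ore_gy p.
  by rewrite -(raddf0 pi); apply: iff_trans (quotmod_pi_eq _ _ _) _; rewrite subr0.
have d0_inj z : d 0%N z = 0 -> z = 0.
  move=> dz; have : [set x | d 0%N x = 0] z by [].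
  by rewrite -d_range => -[t _ <-]; rewrite (P0 2%N lem1 t) (raddf0 (d 1%N)).
have ed z : e (d 0%N z) = 0.
  by have : range (d 0%N) (d 0%N z) by [exists z]; rewrite d0_range.
have e_ker w : e w = 0 -> exists z, d 0%N z = w.
  move=> ew; have : [set x | e x = 0] w by [].
  by rewrite -d0_range => -[z _ <-]; exists z.
have pi_surj : range pi = setT.
  by apply/seteqP; split=> // q _; have [v <-] := quotmod_pi_surj q; exists v.
have [alpha alphaE] := projP 0%N _ _ pi e pi_surj.
have [w0 _ ew0] : range e (pi 1) by rewrite e_surj.
have kerJ z : ore_gy (alpha (d 0%N z)) by apply/pi0; rewrite -[RHS](ed z) -alphaE.
have memJ (p : A^o) : ore_gy p -> p \in submod_pred ore_gy_submodules by move=> Np; apply/asboolP.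
pose inJ (p : A^o) (Np : ore_gy p) : J := exist _ p (memJ p Np).
pose th z : J := inJ _ (kerJ z).
have thL : linear th.
  move=> a u v; apply: val_inj => /=.
  by rewrite (linearP (d 0%N)) (linearP alpha).
have qJ (c : A^o * A^o) : ore_gy (c.1 * C g + c.2 * y) by exists c.1, c.2.
pose q c : J := inJ _ (qJ c).
have qL : linear q.
  move=> a u v; apply: val_inj => /=.
  by rewrite /GRing.scale /= mulrDr !mulrDl !mulrA addrACA.
have q_surj : range q = setT.
  apply/seteqP; split=> // -[p pJ] _; have /asboolP[a [b pE]] := pJ.
  by exists (a, b) => //; apply: val_inj; rewrite /= -pE.
have [k kE] := projP 1%N _ _
  (HB.pack_for {linear (A^o * A^o)%type -> J} q (GRing.isLinear.Build _ _ _ _ q qL))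
  (HB.pack_for {linear P 1%N -> J} th (GRing.isLinear.Build _ _ _ _ th thL)) q_surj.
have {}kE z : (k z).1 * C g + (k z).2 * y = alpha (d 0%N z) := congr1 val (kE z).
have epi (p : A^o) : e (p *: w0) = pi p.
  by rewrite (linearZ_LR e) ew0 -(linearZ_LR pi) /GRing.scale /= mulr1.
have [zg dzg] : exists z, d 0%N z = C g *: w0.
  by apply: e_ker; rewrite epi; apply/pi0; exists 1, 0; rewrite mul1r mul0r addr0.
have [zy dzy] : exists z, d 0%N z = y *: w0.
  by apply: e_ker; rewrite epi; apply/pi0; exists 0, 1; rewrite mul1r mul0r add0r.
(* The relation between [g] and [y] lifts to [P 1] because [d 0] is injective. *)
have rel : (y - C g^`()) *: zg = C g *: zy.
  apply/eqP; rewrite -subr_eq0; apply/eqP/d0_inj.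
  by rewrite (raddfB (d 0%N)) /= !(linearZ_LR (d 0%N)) /= dzg dzy !scalerA ore_twist subrr.
have [c1 [c2 cE]] : ore_gy (1 - alpha w0).
  by apply/pi0; rewrite (raddfB pi) /= -epi scale1r -[e w0]alphaE /= subrr.
(* [k zg] lies over [g * alpha w0]; the term with [(c1, c2)], which lies over [1 - alpha w0],
   corrects this to [g]. *)
pose u := k zg + C g *: ((c1, c2) : A^o * A^o); pose v := k zy + y *: ((c1, c2) : A^o * A^o).
have uv : (y - C g^`()) *: u = C g *: v.
  rewrite /u /v (scalerDr (y - _)) (scalerDr (C g)) -!(linearZ_LR k) rel.
  by rewrite !scalerA ore_twist.
have [u1 u1E] : exists u1, u.1 = C g * u1 by apply: (@ore_twist_regular _ v.1); case: uv.
have [u2 u2E] : exists u2, u.2 = C g * u2 by apply: (@ore_twist_regular _ v.2); case: uv.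
have uE : u.1 * C g + u.2 * y = C g.
  rewrite /u /= !mulrDl addrACA kE dzg (linearZ_LR alpha) /GRing.scale /= -!mulrA -mulrDr.
  by rewrite -cE mulrBr mulr1 addrC subrK.
apply: ore_gy_proper; exists u1, u2; apply: oconst_lreg.
by rewrite mulr1 -[LHS]uE u1E u2E mulrDr !mulrA.
Qed.

End LowerBound.

Lemma ore_lgldim_eq2 (K : fieldType) (g : {poly K}) (A : nzRingType) (D : ore_coords g A) :
  (1 < size g)%N -> lgldim_eq A 2.
Proof.
move=> g1; split; first exact: ore_lgldim_le2 D.
by move=> m /(_ (quotmod (ore_gy_submodules D) : lmodType A)); apply: ore_pdim_ge2.
Qed.

Lemma ore_lKdim_eq2 (K : fieldType) (g : {poly K}) (A : nzRingType) (D : ore_coords g A) :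
  (1 < size g)%N -> lKdim_eq A 2.
Proof. by move=> g1; split; [apply: ore_Kdim_le2 D|apply: ore_Kdim_ge2 D g1]. Qed.

(** * Lambda and its opposite *)

Section LambdaCoords.
Variables (K : fieldType) (f : {poly K}).

Let lcf (p : Lambda f) : {poly {poly K}} := p.

Definition Lambda_coords : ore_coords f (Lambda f).
Proof.
apply: (@OreCoords K f (Lambda f) (oreC (fderivation f)) (Lambda_y f) lcf).
- by move=> p q.
- by move=> p q.
- by [].
- by move=> a p; apply: ore_mulCl.
- by move=> p; apply: ore_lmulyE.
Defined.

End LambdaCoords.

Section Opposite.
Variable K : fieldType.

(* The anti-isomorphism [Lambda f -> Lambda (- f)] fixing [K[x]] and [y]. *)
Definition ore_flip (f h : {poly K}) (p : Lambda f) : Lambda h :=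
  let q : {poly {poly K}} := p in
  \sum_(i < size q) Lambda_y h ^+ i * oreC (fderivation h) q`_i.

Section Flip.
Variables f h : {poly K}.
Hypothesis fh : f + h = 0.
Local Notation Cf := (oreC (fderivation f)).
Local Notation Ch := (oreC (fderivation h)).
Local Notation yf := (Lambda_y f).
Local Notation yh := (Lambda_y h).
Local Notation flip := (@ore_flip f h).

Lemma ore_flip_wide n (p : {poly {poly K}}) : (size p <= n)%N ->
  flip p = \sum_(i < n) yh ^+ i * Ch p`_i.
Proof.
move=> lepn; rewrite /ore_flip (big_ord_widen n (fun i => yh ^+ i * Ch p`_i)) //.
rewrite big_mkcond; apply: eq_bigr => i _; case: ltnP => // lepi.
by rewrite nth_default // rmorph0 mulr0.
Qed.

Fact ore_flip_is_zmod_morphism : zmod_morphism flip.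
Proof.
move=> p q; pose n := maxn (size (p : {poly {poly K}})) (size (q : {poly {poly K}})).
rewrite !(@ore_flip_wide n) ?leq_maxl ?leq_maxr //; last first.
  by rewrite (leq_trans (size_polyD _ _)) // size_polyN.
rewrite -sumrB; apply: eq_bigr => i _.
by rewrite -mulrBr -rmorphB; congr (_ * Ch _); apply: coefB.
Qed.
HB.instance Definition _ :=
  GRing.isZmodMorphism.Build (Lambda f) (Lambda h) flip ore_flip_is_zmod_morphism.

Lemma ore_flipE a i : flip (Cf a * yf ^+ i) = yh ^+ i * Ch a.
Proof.
have -> : Cf a * yf ^+ i = a *: 'X^i :> {poly {poly K}}.
  have := ocfZ (Lambda_coords f) a (yf ^+ i).
  by rewrite (ocfYXn (Lambda_coords f)).
rewrite (@ore_flip_wide i.+1) ?(leq_trans (size_scale_leq _ _)) ?size_polyXn //.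
rewrite big_ord_recr /= coefZ coefXn eqxx mulr1 big1 ?add0r // => j _.
by rewrite coefZ coefXn ltn_eqF ?mulr0 ?rmorph0 ?mulr0.
Qed.

Lemma ore_flipC a : flip (Cf a) = Ch a.
Proof. by have := ore_flipE a 0; rewrite !expr0 mulr1 mul1r. Qed.

Lemma ore_flipY : flip yf = yh.
Proof. by have := ore_flipE 1 1; rewrite !expr1 !rmorph1 mulr1 mul1r. Qed.

Lemma ore_flipM p q : flip (p * q) = flip q * flip p.
Proof.
have CM a r : flip (Cf a * r) = flip r * flip (Cf a).
  rewrite ore_flipC.
  elim/(@ore_coords_ind _ _ _ (Lambda_coords f)): r => [|r s rE sE|b i].
  - by rewrite mulr0 raddf0 mul0r.
  - by rewrite mulrDr !raddfD /= mulrDl rE sE.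
  by rewrite mulrA -rmorphM !ore_flipE -mulrA -rmorphM mulrC [b * a]mulrC mulrC.
have YM r : flip (yf * r) = flip r * flip yf.
  rewrite ore_flipY.
  elim/(@ore_coords_ind _ _ _ (Lambda_coords f)): r => [|r s rE sE|b i].
  - by rewrite mulr0 raddf0 mul0r.
  - by rewrite mulrDr !raddfD /= mulrDl rE sE.
  (* The two commutation rules contribute $fb'$ and $hb'$, which cancel since $f+h=0$. *)
  rewrite mulrA /Lambda_y ore_yC mulrDl -mulrA -exprS raddfD /= !ore_flipE.
  rewrite exprSr -mulrA ore_yC mulrDr -addrA -mulrDr -rmorphD /= /fderiv -mulrDl.
  by rewrite [h + f]addrC fh mul0r rmorph0 mulr0 addr0 mulrA.
elim/(@ore_coords_ind _ _ _ (Lambda_coords f)): p q => [q|p1 p2 p1E p2E q|a i q].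
- by rewrite mul0r raddf0 mulr0.
- by rewrite mulrDl !raddfD /= mulrDr p1E p2E.
have YXM r : flip (yf ^+ i * r) = flip r * flip (yf ^+ i).
  elim: i r => [|i IHi] r.
    by rewrite expr0 mul1r -(rmorph1 Cf) ore_flipC rmorph1 mulr1.
  by rewrite exprS -mulrA !YM IHi mulrA.
by rewrite -mulrA !CM YXM mulrA.
Qed.

End Flip.

Lemma ore_flipK (f h : {poly K}) : f + h = 0 -> cancel (@ore_flip f h) (@ore_flip h f).
Proof.
move=> fh p; have hf : h + f = 0 by rewrite addrC.
elim/(@ore_coords_ind _ _ _ (Lambda_coords f)): p => [|p q pE qE|a i].
- by rewrite !raddf0.
- by rewrite !raddfD /= pE qE.
rewrite ore_flipE ore_flipM // ore_flipC; congr (_ * _).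
elim: i => [|i IHi]; first by rewrite !expr0 -(rmorph1 (oreC (fderivation h))) ore_flipC rmorph1.
by rewrite exprSr ore_flipM // IHi ore_flipY exprS.
Qed.

Fact opp_oconst_is_monoid_morphism (f : {poly K}) :
  monoid_morphism (oreC (fderivation f) : {poly K} -> (Lambda f)^c).
Proof. by split=> [|a b]; rewrite ?rmorph1 // mulrC rmorphM. Qed.

(** The opposite product of [y] and [a] is $ay=ya-fa'$ in [Lambda f], whence the sign; the flip
    gives the normal form with coefficients on the left for the opposite product. *)
Definition Lambda_opp_coords (f : {poly K}) : ore_coords (- f) (Lambda f)^c.
Proof.
have fN : f - f = 0 by rewrite subrr.
pose C : {poly K} -> (Lambda f)^c := oreC (fderivation f).
pose Cm := HB.pack_for {rmorphism {poly K} -> (Lambda f)^c} C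
  (GRing.isZmodMorphism.Build _ _ C (rmorphB (oreC (fderivation f))))
  (GRing.isMonoidMorphism.Build _ _ C (opp_oconst_is_monoid_morphism f)).
apply: (@OreCoords K (- f) (Lambda f)^c Cm (Lambda_y f) (@ore_flip f (- f))).
- exact: ore_flip_is_zmod_morphism.
- exact: can_inj (ore_flipK fN).
- by have := ore_flipC f (- f) 1; rewrite !rmorph1.
- move=> a p; apply: (etrans (ore_flipM fN p (oreC (fderivation f) a))).
  by rewrite ore_flipC; apply: ore_mulCl.
- move=> p; apply: (etrans (ore_flipM fN p (Lambda_y f))).
  by rewrite ore_flipY; apply: ore_lmulyE.
Defined.

End Opposite.

Theorem theorem2p5 (K : fieldType) (p : nat) (f : {poly K})
    (charK : p \in [pchar K]) (f_nonconst : (1 < size f)%N) :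
  (lKdim_eq (Lambda f) 2 /\ rKdim_eq (Lambda f) 2) /\
  (lgldim_eq (Lambda f) 2 /\ rgldim_eq (Lambda f) 2).
Proof.
have fN_nonconst : (1 < size (- f))%N by rewrite size_polyN.
have L := Lambda_coords f; have R := Lambda_opp_coords f.
by split; split; [apply: ore_lKdim_eq2 L _|apply: ore_lKdim_eq2 R _
  |apply: ore_lgldim_eq2 L _|apply: ore_lgldim_eq2 R _].
Qed.
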